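(* Algorithm 1 (the dynamic program specified in the context, with the sets $\mathcal{F}_{G,j}$ defined there for AdsSched) solves the AdsSched problem with $k$ clients, $n$ time points, per-time capacity $l$ and diversity parameter $\omega$ optimally, in time $O(n\,k^{l}\,\omega^{k})$.
   Context: **AdsSched.** A company manages advertisements from $k$ clients ($k$ a constant independent of $n$) over $n$ discrete time points. At each time point the advertisements of some given subset of clients are available. At most $l$ advertisements can be aired at each time point, and a diversity policy with parameter $\omega$ limits repeated airing of the same client: in any $\omega$ consecutive time points at most one advertisement of each client may be aired. The goal is to schedule the airings subject to these constraints so as to maximize the number of advertisements aired. An instance is encoded by an array $G$ with rows $1,\dots,k$ (clients) and columns $-(\omega-1),\dots,n$, where for $1\le j\le n$ we have $G[i,j]=1$ if an advertisement of client $i$ is available at time $j$ and $G[i,j]=0$ otherwise, and all columns $j\le 0$ are zero. **Notation.** $A[j_1:j_2]$ is the sub-array of columns $j_1,\dots,j_2$ of $A$, and $A[j]$ is column $j$. $A_1\le_a A_2$ means entrywise $\le$. $A_1\vDash A_2$ means that $A_1$ without its first column equals $A_2$ without its last column. For each $j$, $\mathcal{F}_{G,j}$ is the set of $k\times\omega$ arrays $W$ of zeros and ones such that (i) $W\le_a G[j-\omega+1:j]$; (ii) $W$ contains at most one non-zero element in each row; (iii) $W$ contains at most $l$ non-zero elements in each column. **Algorithm 1.** 1. Initialisation: set $\mathrm{MIS}[0,\vec 0]=0$, where $\vec 0$ is the all-zero $k\times\omega$ array; set $\mathrm{MIS}[j,W]=0$ for all $j=1,\dots,n$ and all feasible $W$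 ($0/1$ arrays of size $k\times\omega$ satisfying (ii) and (iii)). 2. For $j=1,\dots,n$ and for each $W\in\mathcal{F}_{G,j}$: let $W^*\in\mathcal{F}_{G,j-1}$ with $W^*\vDash W$ maximize $\mathrm{MIS}[j-1,W^*]$; set $\mathrm{MIS}[j,W]=\langle W[\omega],G[j]\rangle+\mathrm{MIS}[j-1,W^*]$, where $\langle\cdot,\cdot\rangle$ is the sum of products of corresponding entries of the last column $W[\omega]$ of $W$ and column $j$ of $G$; set $\mathrm{pred}[j,W]=W^*$. 3. Retrieval: find $W^*\in\mathcal{F}_{G,n}$ maximizing $\mathrm{MIS}[n,W^*]$ and let $I$ be the rightmost column of $W^*$. For $j=n$ down to $2$: replace $W^*$ by $\mathrm{pred}[j,W^*]$, then redefine $I$ as the rightmost column of this new $W^*$ concatenated with $I$. Return $I$, a $k\times n$ array whose non-zero entries mark the aired advertisements. *)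

(* Defs.v *)
From mathcomp Require Import all_boot all_order all_algebra.
Set Implicit Arguments.
Unset Strict Implicit.
Unset Printing Implicit Defensive.

(** * The AdsSched problem

    Client [i : 'I_k] has an advertisement available at time point [t.+1]
    iff [A i t]; time points 1..n are the ordinals [t : 'I_n] shifted by one. *)

(* The diversity policy is imposed on every run of [w] consecutive time points
   that meets 1..n, including runs that overhang the horizon: two airings of the
   same client are always at least [w] apart, even when [n < w]. *)
Definition feasible_schedule (k n l w : nat) (A X : 'M[bool]_(k, n)) : Prop :=
  [/\ forall (i : 'I_k) (t : 'I_n), X i t -> A i t,
      forall t : 'I_n, \sum_(i < k) X i t <= l
    & forall (i : 'I_k) (s : nat), \sum_(t < n | s <= t < s + w) X i t <= 1].

Definition airings (k n : nat) (X : 'M[bool]_(k, n)) : nat :=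
  \sum_(i < k) \sum_(t < n) X i t.

Definition optimal_schedule (k n l w : nat) (A X : 'M[bool]_(k, n)) : Prop :=
  feasible_schedule l w A X /\
  forall Y : 'M[bool]_(k, n), feasible_schedule l w A Y -> airings Y <= airings X.

(** * The dynamic program *)

(* The instance array G: column [j] is column [j - 1] of [A] for 1 <= j <= n, and every
   other column is zero. *)
Definition padded (k n : nat) (A : 'M[bool]_(k, n)) (i : 'I_k) (j : int) : bool :=
  if j is Posz j'.+1 then oapp (A i) false (insub j' : option 'I_n) else false.

(* The column of G lying under column [p] (counted from 0) of a window of width
   [w] whose last column is at time [j]. *)
Definition window_time (w j p : nat) : int := (j%:Z - w%:Z + 1 + p%:Z)%R.

Definition feasible_window (k l w : nat) (W : 'M[bool]_(k, w)) : bool :=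
  [forall i : 'I_k, \sum_(p < w) W i p <= 1] &&
  [forall p : 'I_w, \sum_(i < k) W i p <= l].

Definition windows (k n l w : nat) (A : 'M[bool]_(k, n)) (j : nat) :
    {set 'M[bool]_(k, w)} :=
  [set W : 'M[bool]_(k, w) |
     [forall i : 'I_k, forall p : 'I_w, W i p ==> padded A i (window_time w j p)]
     && feasible_window l W].

(* [W1] without its first column equals [W2] without its last column. *)
Definition overlaps (k w : nat) (W1 W2 : 'M[bool]_(k, w)) : bool :=
  [forall i : 'I_k, forall p : 'I_w, forall q : 'I_w,
     (p == q.+1 :> nat) ==> (W1 i p == W2 i q)].

Definition last_column (k w : nat) (W : 'M[bool]_(k, w)) (i : 'I_k) : bool :=
  [exists p : 'I_w, (p.+1 == w) && W i p].

Definition gain (k n w : nat) (A : 'M[bool]_(k, n)) (j : nat)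
    (W : 'M[bool]_(k, w)) : nat :=
  \sum_(i < k) last_column W i * padded A i j%:Z.

(* [MIS], [pred] and [I] are the tables and the output of an execution of the
   algorithm, with an arbitrary choice among the maximizers at each step. *)
Record algorithm1_run (k n l w : nat) (A : 'M[bool]_(k, n))
    (MIS : nat -> 'M[bool]_(k, w) -> nat)
    (pred : nat -> 'M[bool]_(k, w) -> 'M[bool]_(k, w))
    (I : 'M[bool]_(k, n)) : Prop := Algorithm1Run {
  run_init0 : MIS 0 (const_mx false) = 0;
  (* feasible windows not below G are never updated *)
  run_init : forall (j : nat) (W : 'M[bool]_(k, w)),
    0 < j <= n -> feasible_window l W -> W \notin windows l w A j -> MIS j W = 0;
  run_pred : forall (j : nat) (W : 'M[bool]_(k, w)),
    0 < j <= n -> W \in windows l w A j ->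
    [/\ pred j W \in windows l w A j.-1,
        overlaps (pred j W) W
      & forall W' : 'M[bool]_(k, w), W' \in windows l w A j.-1 ->
          overlaps W' W -> MIS j.-1 W' <= MIS j.-1 (pred j W)];
  run_MIS : forall (j : nat) (W : 'M[bool]_(k, w)),
    0 < j <= n -> W \in windows l w A j ->
    MIS j W = gain A j W + MIS j.-1 (pred j W);
  run_retrieval : exists V : nat -> 'M[bool]_(k, w),
    [/\ V n \in windows l w A n,
        forall W' : 'M[bool]_(k, w), W' \in windows l w A n -> MIS n W' <= MIS n (V n),
        forall j : nat, 1 < j <= n -> V j.-1 = pred j (V j)
      & forall (i : 'I_k) (t : 'I_n), I i t = last_column (V t.+1) i]
}.

(** * A unit-cost random access machine

    Running times are counted on a small imperative language: memory consists of
    named two-dimensional arrays of words, a scalar being the cell [0, 0] of its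
    array, and every memory access, constant, arithmetic operation, comparison,
    branch and loop iteration costs one step. *)

Inductive var : Set :=
  (* input *)
  | vk | vl | vn | vw | vG
  (* tables and output *)
  | vMIS | vPRED | vOUT
  (* working storage *)
  | vPOW | vTWO | vj | vt | vc | vd | vm | vi | vi' | vx | vb | vcnt | vOK
  | vVALID | vFOUND | vBEST | vARG | vGAIN.

Scheme Equality for var.

Inductive op : Set := Add | Sub | Mul | Div | Mod | Eq | Le.

Inductive exp : Type :=
  | Num of nat
  | Cell of var & exp & exp
  | Bin of op & exp & exp.

Inductive com : Type :=
  | Skip
  | Assign of var & exp & exp & exp
  | Seq of com & com
  | If of exp & com & com
  (* [For x e c]: [e] is evaluated once, and [c] is run for x = 0, 1, .., e - 1 *)
  | For of var & exp & com.

Definition state : Type := var -> nat -> nat -> nat.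

Definition upd (s : state) (x : var) (a b v : nat) : state :=
  fun y a' b' => if [&& var_beq x y, a == a' & b == b'] then v else s y a' b'.

Definition eval_op (o : op) (a b : nat) : nat :=
  match o with
  | Add => a + b
  | Sub => a - b
  | Mul => a * b
  | Div => a %/ b
  | Mod => a %% b
  | Eq => a == b
  | Le => a <= b
  end.

Fixpoint eval (e : exp) (s : state) : nat :=
  match e with
  | Num m => m
  | Cell x e1 e2 => s x (eval e1 s) (eval e2 s)
  | Bin o e1 e2 => eval_op o (eval e1 s) (eval e2 s)
  end.

Fixpoint exp_time (e : exp) : nat :=
  match e with
  | Num _ => 1
  | Cell _ e1 e2 => (exp_time e1 + exp_time e2).+1
  | Bin _ e1 e2 => (exp_time e1 + exp_time e2).+1
  end.

Fixpoint exec (c : com) (s : state) : state :=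
  match c with
  | Skip => s
  | Assign x e1 e2 e => upd s x (eval e1 s) (eval e2 s) (eval e s)
  | Seq c1 c2 => exec c2 (exec c1 s)
  | If e c1 c2 => if eval e s != 0 then exec c1 s else exec c2 s
  | For x e c1 => iteri (eval e s) (fun v s' => exec c1 (upd s' x 0 0 v)) s
  end.

Fixpoint time (c : com) (s : state) : nat :=
  match c with
  | Skip => 1
  | Assign x e1 e2 e => (exp_time e1 + exp_time e2 + exp_time e).+1
  | Seq c1 c2 => time c1 s + time c2 (exec c1 s)
  | If e c1 c2 =>
      (exp_time e + (if eval e s != 0 then time c1 s else time c2 s)).+1
  | For x e c1 =>
      (exp_time e +
       \sum_(v < eval e s)
          (time c1 (upd (iteri v (fun v' s' => exec c1 (upd s' x 0 0 v')) s)
                        x 0 0 v)).+1).+1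
  end.

Declare Scope ram_scope.
Delimit Scope ram_scope with ram.
Bind Scope ram_scope with exp com.

Coercion Num : nat >-> exp.
Definition scalar (x : var) : exp := Cell x (Num 0) (Num 0).
Coercion scalar : var >-> exp.

Notation "x @[ a , b ]" := (Cell x a%ram b%ram)
  (at level 2, left associativity, format "x @[ a ,  b ]") : ram_scope.
Notation "a + b" := (Bin Add a%ram b%ram) : ram_scope.
Notation "a - b" := (Bin Sub a%ram b%ram) : ram_scope.
Notation "a * b" := (Bin Mul a%ram b%ram) : ram_scope.
Notation "a %/ b" := (Bin Div a%ram b%ram) : ram_scope.
Notation "a %% b" := (Bin Mod a%ram b%ram) : ram_scope.
Notation "a == b" := (Bin Eq a%ram b%ram) : ram_scope.
Notation "a <= b" := (Bin Le a%ram b%ram) : ram_scope.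
Notation "x <~ e" := (Assign x (Num 0) (Num 0) e%ram) (at level 75) : ram_scope.
Notation "x <~[ a , b ] e" := (Assign x a%ram b%ram e%ram)
  (at level 75, a at level 70, b at level 70) : ram_scope.
Notation "c1 ;; c2" := (Seq c1%ram c2%ram)
  (at level 90, right associativity) : ram_scope.

(** * The dynamic program on the machine

    A window with at most one one per row is held in one word: its row [i] contributes the
    digit [i] in base [w + 1], namely 0 if the row is zero and [p + 1] if the row
    has its one in column [p] (counted from 0). All words occurring in the
    program stay polynomial in [n] and [w] for fixed [k]. *)

Definition encode (k w : nat) (W : 'M[bool]_(k, w)) : nat :=
  \sum_(i < k) (\sum_(p < w) W i p * p.+1) * w.+1 ^ i.

Definition decode (k w : nat) (c : nat) : 'M[bool]_(k, w) :=
  \matrix_(i < k, p < w) (c %/ w.+1 ^ i %% w.+1 == p.+1).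

Local Open Scope ram_scope.

Definition digit (c i : exp) : exp := (c %/ vPOW@[i, 0]) %% (vw + 1).

(* OK := the window coded by [c] has at most [l] ones in each column; comparing
   the rows pairwise keeps the cost independent of [w]. *)
Definition check_feasible (c : exp) : com :=
  vOK <~ 1;;
  For vi vk (
    vcnt <~ 0;;
    For vi' vk (
      If ((1 <= digit c vi) * (digit c vi == digit c vi'))
         (vcnt <~ vcnt + 1) Skip);;
    If (vcnt <= vl) Skip (vOK <~ 0)).

(* OK := the window coded by [c] belongs to [windows l w A j]; column [j - w + d] of G
   is stored at index [j + d - 1] of the array vG *)
Definition check_window (j c : exp) : com :=
  check_feasible c;;
  For vi vk (
    If (1 <= digit c vi)
       (vOK <~ vOK * vG@[vi, j + digit c vi - 1]) Skip).

(* The subset [vm] of the rows is a tentative first column. VALID := some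
   window with this first column and at most one one per row overlaps the window
   coded by [vc]; if so, [vd] is its code. Only the rows of [vc] that vanish
   outside the last column may have a one in that first column. *)
Definition make_predecessor : com :=
  vd <~ 0;;
  vVALID <~ 1;;
  For vi vk (
    vx <~ digit vc vi;;
    vb <~ (vm %/ vTWO@[vi, 0]) %% 2;;
    If ((vx == 0) + (vx == vw))
       (vd <~ vd + vb * vPOW@[vi, 0])
       (If vb (vVALID <~ 0) (vd <~ vd + (vx + 1) * vPOW@[vi, 0]))).

(* Keeps in ARG the code with the largest MIS entry met so far in row [j]. *)
Definition keep_best (j c : exp) : com :=
  If ((vFOUND == 0) + (vBEST + 1 <= vMIS@[j, c]))
     (vFOUND <~ 1;; vBEST <~ vMIS@[j, c];; vARG <~ c) Skip.

Definition powers : com :=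
  vPOW <~[0, 0] 1;;
  vTWO <~[0, 0] 1;;
  For vi vk (
    vPOW <~[vi + 1, 0] vPOW@[vi, 0] * (vw + 1);;
    vTWO <~[vi + 1, 0] vTWO@[vi, 0] * 2).

Definition initialisation : com :=
  vMIS <~[0, 0] 0;;
  For vt vn (
    For vc vPOW@[vk, 0] (
      check_feasible vc;;
      If vOK (vMIS <~[vt + 1, vc] 0) Skip)).

Definition main_loop : com :=
  For vt vn (
    vj <~ vt + 1;;
    For vc vPOW@[vk, 0] (
      check_window vj vc;;
      If vOK (
        vFOUND <~ 0;;
        For vm vTWO@[vk, 0] (
          make_predecessor;;
          If vVALID (
            check_window (vj - 1) vd;;
            If vOK (keep_best (vj - 1) vd) Skip) Skip);;
        vGAIN <~ 0;;
        For vi vk (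
          vGAIN <~ vGAIN + (digit vc vi == vw) * vG@[vi, vj + vw - 1]);;
        vMIS <~[vj, vc] vGAIN + vMIS@[vj - 1, vARG];;
        vPRED <~[vj, vc] vARG) Skip)).

Definition output_column (j : exp) : com :=
  For vi vk (vOUT <~[vi, j] (digit vARG vi == vw)).

Definition retrieval : com :=
  vFOUND <~ 0;;
  For vc vPOW@[vk, 0] (
    check_window vn vc;;
    If vOK (keep_best vn vc) Skip);;
  output_column vn;;
  For vt (vn - 1) (
    vj <~ vn - vt;;
    vARG <~ vPRED@[vj, vARG];;
    output_column (vj - 1)).

Definition algorithm1 : com :=
  powers;; initialisation;; main_loop;; retrieval.

Local Close Scope ram_scope.

(* Columns -(w - 1), .., n of G are stored at indices 0, .., n + w - 1. The rest
   of the memory is arbitrary. *)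
Definition input_state (k n l w : nat) (A : 'M[bool]_(k, n)) (s : state) : Prop :=
  [/\ s vk 0 0 = k, s vl 0 0 = l, s vn 0 0 = n, s vw 0 0 = w
    & forall (i : 'I_k) (c : nat), c < n + w ->
        s vG i c = padded A i (c%:Z - w%:Z + 1)%R].

Definition MIS_table (k w : nat) (s : state) (j : nat) (W : 'M[bool]_(k, w)) : nat :=
  s vMIS j (encode W).

Definition pred_table (k w : nat) (s : state) (j : nat) (W : 'M[bool]_(k, w)) :
    'M[bool]_(k, w) :=
  decode k w (s vPRED j (encode W)).

Definition output (k n : nat) (s : state) : 'M[bool]_(k, n) :=
  \matrix_(i < k, t < n) (s vOUT i t.+1 != 0).

(* Main.v *)
(* A schedule X is feasible iff for every j <= n the w columns of X ending at time j form
   a window of the j-th family. Feasible schedules are thus the chains of overlapping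
   windows, the airings of X being the sum of the gains along its chain. The backward
   path of a run is such a chain, its value is exactly the table entry it starts from,
   and by induction on j the table dominates the value of every chain.

   For the machine, every variable holds after the execution of a command what it held
   before unless the command writes it, and windows are handled through the base w + 1
   digits of their codes. A predecessor of W is determined by its first column, where
   only the rows of W that vanish outside the last column may have a one: the 2^k
   subsets of rows exhaust the predecessors. The main loop thus spends a time depending
   only on k on each of the n (w + 1)^k <= 2^k n w^k cells, and 1 <= k^l. *)

Require Import Defs.
From mathcomp Require Import all_boot all_order all_algebra.
From mathcomp Require Import zify.

Set Implicit Arguments.
Unset Strict Implicit.
Unset Printing Implicit Defensive.

(** * Optimality of an arbitrary run *)

(** Both the diversity policy and the row condition on windows are counts bounded by one; all later
    arguments use them as uniqueness statements. *)
Lemma sum_bool_le1P (T : finType) (P : pred T) (b : T -> bool) :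
  \sum_(x | P x) b x <= 1 <->
  (forall x y, P x -> P y -> b x -> b y -> x = y).
Proof.
have -> : \sum_(x | P x) (b x : nat) = #|[pred x | P x && b x]|.
  rewrite -sum1_card big_mkcondr /=.
  by apply: eq_bigr => x _; case: (b x).
split=> [/card_le1_eqP h x y Px Py bx by_ | h].
  by apply: h; rewrite inE ?Px ?Py.
apply/card_le1_eqP => x y; rewrite !inE => /andP[Px bx] /andP[Py by_].
exact: h.
Qed.

Lemma padded_ord (k n : nat) (X : 'M[bool]_(k, n)) i (t : 'I_n) :
  padded X i (Posz t.+1) = X i t.
Proof. by rewrite /= valK. Qed.

Lemma paddedP (k n : nat) (X : 'M[bool]_(k, n)) i z :
  padded X i z -> exists2 t : 'I_n, z = Posz t.+1 & X i t.
Proof.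
case: z => [[|z]|z] //=; case: insubP => [t _ vt|] //= Xit.
by exists t; rewrite ?vt.
Qed.

(** * Schedules as chains of windows *)

Definition window_of (k n w : nat) (X : 'M[bool]_(k, n)) (j : nat) :
    'M[bool]_(k, w) :=
  \matrix_(i < k, p < w) padded X i (window_time w j p).

(** Trades integer times for an equation between naturals without truncated subtraction, which [lia]
    combines with the bounds on the ordinals. *)
Lemma window_timeE (w j p : nat) (t : nat) :
  (window_time w j p == Posz t.+1) = (j + p == t + w).
Proof. by rewrite /window_time; apply/eqP/eqP; lia. Qed.

Lemma window_of_overlaps (k n w : nat) (X : 'M[bool]_(k, n)) j :
  0 < j -> overlaps (window_of w X j.-1) (window_of w X j).
Proof.
move=> j0; apply/'forall_forallP => i p; apply/forallP => q.
apply/implyP => /eqP pq; rewrite !mxE.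
suff -> : window_time w j.-1 p = window_time w j q by [].
by rewrite /window_time; lia.
Qed.

Lemma last_columnE (k w : nat) (W : 'M[bool]_(k, w)) i (p : 'I_w) :
  p.+1 = w -> last_column W i = W i p.
Proof.
move=> pw; apply/existsP/idP => [[q /andP[/eqP qw Wq]]|Wp].
  by rewrite (_ : p = q) //; apply: val_inj => /=; lia.
by exists p; rewrite pw eqxx.
Qed.

Lemma windowsP (k n l w : nat) (A : 'M[bool]_(k, n)) j (W : 'M[bool]_(k, w)) :
  reflect [/\ forall i p, W i p -> padded A i (window_time w j p),
              forall i, \sum_(p < w) W i p <= 1
            & forall p, \sum_(i < k) W i p <= l]
          (W \in windows l w A j).
Proof.
rewrite inE; apply: (iffP and3P) => [] [h1 h2 h3]; split.
- by move=> i p Wip; move/'forall_forallP: h1 => /(_ i p); rewrite Wip.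
- exact/forallP.
- exact/forallP.
- by apply/'forall_forallP => i p; apply/implyP/h1.
- exact/forallP.
- exact/forallP.
Qed.

(** Two airings of a client less than [w] apart both lie in the window that ends at the later one,
    and conversely a window meets the horizon inside one run of [w] time points. *)
Lemma feasible_scheduleP (k n l w : nat) (A X : 'M[bool]_(k, n)) : 0 < w ->
  feasible_schedule l w A X <->
  (forall j, j <= n -> window_of w X j \in windows l w A j).
Proof.
move=> w0; split=> [[XA cap div] j jn | h].
  apply/windowsP; split=> [i p|i|p].
  - by rewrite mxE => /paddedP [t -> Xt]; rewrite padded_ord; apply: XA.
  - apply/sum_bool_le1P => p q _ _; rewrite !mxE.
    move=> /paddedP [t /eqP + Xt] /paddedP [u /eqP + Xu].
    rewrite !window_timeE => /eqP et /eqP eu.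
    (* When [j < w] the truncated [j - w] is 0: the columns before time 1 are zero, and the run
       starting at the first time point still covers the rest. *)
    have /sum_bool_le1P/(_ t u) := div i (j - w).
    have := ltn_ord p; have := ltn_ord q => q1 p1.
    move=> /(_ ltac:(lia) ltac:(lia) Xt Xu) tu.
    by apply: val_inj => /=; rewrite tu in et; lia.
  - case: (ltnP (j + p) w) => [jp|jp].
      rewrite big1 // => i _; rewrite mxE.
      case E: (padded _ _ _) => //; case/paddedP: E => t /eqP.
      by rewrite window_timeE => /eqP; lia.
    have tn : j + p - w < n by have := ltn_ord p; lia.
    apply: leq_trans (cap (Ordinal tn)); apply: leq_sum => i _.
    rewrite mxE; suff -> : window_time w j p = Posz (j + p - w).+1.
      by rewrite -(padded_ord X i (Ordinal tn)).
    by apply/eqP; rewrite window_timeE; apply/eqP; lia.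
have wp : w.-1 < w by rewrite prednK.
split=> [i t Xt|t|i s].
- have /windowsP[/(_ i (Ordinal wp)) + _ _] := h t.+1 (ltn_ord t).
  have tw : window_time w t.+1 w.-1 = Posz t.+1.
    by apply/eqP; rewrite window_timeE; apply/eqP; lia.
  by rewrite mxE tw !padded_ord; apply.
- have /windowsP[_ _ /(_ (Ordinal wp))] := h t.+1 (ltn_ord t).
  have tw : window_time w t.+1 w.-1 = Posz t.+1.
    by apply/eqP; rewrite window_timeE; apply/eqP; lia.
  by under eq_bigr => i _ do rewrite mxE tw padded_ord.
- apply/sum_bool_le1P.
  (* In the window ending at time [u.+1], airing [u] is in the last column and airing [t] in column
     [t + w - u.+1]. *)
  have tu (t u : 'I_n) : t <= u < t + w -> X i t -> X i u -> t = u.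
    move=> ltu Xt Xu.
    have /windowsP[_ /(_ i)/sum_bool_le1P + _] := h u.+1 (ltn_ord u).
    have pt : t + w - u.+1 < w by lia.
    move=> /(_ (Ordinal pt) (Ordinal wp) isT isT); rewrite !mxE.
    have -> : window_time w u.+1 (Ordinal pt) = Posz t.+1.
      by apply/eqP; rewrite window_timeE /=; apply/eqP; lia.
    have -> : window_time w u.+1 (Ordinal wp) = Posz u.+1.
      by apply/eqP; rewrite window_timeE /=; apply/eqP; lia.
    rewrite !padded_ord => /(_ Xt Xu) /(congr1 val) /= e.
    by apply: val_inj => /=; lia.
  move=> t u ht hu Xt Xu; case: (leqP t u) => ltu.
    by apply: tu => //; lia.
  by apply/esym/tu => //; lia.
Qed.

(** Each airing is counted once, in the window whose last column is at its own time; the factor from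
    G equals one there because X lies below A. *)
Lemma airings_gain (k n w : nat) (A X : 'M[bool]_(k, n)) : 0 < w ->
  (forall i t, X i t -> A i t) ->
  airings X = \sum_(t < n) gain A t.+1 (window_of w X t.+1).
Proof.
move=> w0 XA; rewrite /airings exchange_big /=.
apply: eq_bigr => t _; apply: eq_bigr => i _.
have wp : w.-1 < w by rewrite prednK.
rewrite (@last_columnE _ _ _ i (Ordinal wp)) ?prednK // mxE.
have -> : window_time w t.+1 (Ordinal wp) = Posz t.+1.
  by apply/eqP; rewrite window_timeE /=; apply/eqP; lia.
by rewrite !padded_ord; case: (X i t) (XA i t) => // ->.
Qed.

(** All columns of a window ending at time 0 lie where G vanishes, so the recursion has a single
    base case. *)
Lemma windows0 (k n l w : nat) (A : 'M[bool]_(k, n)) (W : 'M[bool]_(k, w)) :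
  W \in windows l w A 0 -> W = const_mx false.
Proof.
case/windowsP=> h _ _; apply/matrixP => i p; rewrite mxE.
apply/negP => /h /paddedP [t /eqP]; rewrite window_timeE => /eqP.
by have := ltn_ord p; lia.
Qed.

Lemma algorithm1_run_optimal (k n l w : nat) (A : 'M[bool]_(k, n)) MIS pred I :
  0 < n -> 0 < w -> @algorithm1_run k n l w A MIS pred I ->
  optimal_schedule l w A I.
Proof.
move=> n0 w0 [init0 _ predP MISE [U [Un Umax Upred IU]]].
(* Retrieval stops at time 1; the path is prolonged to time 0 by one more predecessor, so that it
   starts at the zero window. *)
pose V j := if j is 0 then pred 1 (U 1) else U j.
have VU j : 0 < j -> V j = U j by case: j.
(* Membership travels backward along [pred], hence an induction on the distance to [n]. *)
have Vwin j : j <= n -> V (n - j) \in windows l w A (n - j).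
  elim: j => [|j IH] jn; first by rewrite subn0 VU.
  have nj : 0 < n - j <= n by lia.
  have [h _ _] := predP _ _ nj (IH (ltnW jn)).
  have -> : n - j.+1 = (n - j).-1 by lia.
  case: (ltnP 1 (n - j)) => [lt1|le1].
    by rewrite VU ?Upred -?VU; [exact: h | lia | lia | lia].
  have e1 : n - j = 1 by lia.
  by rewrite e1 in h *.
have {}Vwin j : j <= n -> V j \in windows l w A j.
  by move=> jn; have := Vwin _ (leq_subr j n); rewrite subKn.
have Vpred j : j < n -> V j = pred j.+1 (V j.+1).
  by case: j => // j jn; rewrite !VU // -Upred.
(* The last column of [V j] is a column of [I] by retrieval; the other columns come from [V j.-1] by
   overlap. *)
have VI j : j <= n -> V j = window_of w I j.
  elim: j => [|j IH] jn; apply/matrixP => i p; rewrite [RHS]mxE.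
    rewrite (windows0 (Vwin _ jn)) mxE; apply/esym/negP => /paddedP[t /eqP].
    by rewrite window_timeE => /eqP; have := ltn_ord p; lia.
  have [_ ov _] := predP j.+1 (V j.+1) jn (Vwin _ jn).
  case: (eqVneq p.+1 w) => [pw|pw].
    have -> : window_time w j.+1 p = Posz (Ordinal jn).+1.
      by apply/eqP; rewrite window_timeE /=; apply/eqP; lia.
    by rewrite padded_ord IU (@last_columnE _ _ _ i p).
  have p1 : p.+1 < w by rewrite ltn_neqAle pw ltn_ord.
  have /'forall_forallP/(_ i (Ordinal p1))/forallP/(_ p) := ov.
  rewrite eqxx -Vpred //= => /eqP <-; rewrite IH ?mxE; last exact: ltnW.
  by congr padded; rewrite /window_time /=; lia.
have feas : feasible_schedule l w A I.
  by apply/feasible_scheduleP => // j jn; rewrite -VI ?Vwin.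
split=> // Y feasY.
have win_sub X : feasible_schedule l w A X -> forall i t, X i t -> A i t.
  by case.
rewrite (airings_gain w0 (win_sub _ feas)) (airings_gain w0 (win_sub _ feasY)).
move/(feasible_scheduleP l A Y w0): feasY => Ywin.
have MISV j : j <= n ->
    MIS j (V j) = \sum_(t < j) gain A t.+1 (window_of w I t.+1).
  elim: j => [|j IH] jn.
    by rewrite (windows0 (Vwin _ jn)) init0 big_ord0.
  rewrite MISE ?Vwin // -Vpred // VI // -[j.+1.-1]/j IH ?(ltnW jn) //.
  by rewrite big_ord_recr addnC.
(* The windows of [Y] form a competing chain: each is an admissible predecessor of the next, so the
   chosen predecessor has at least its entry. *)
have MISY j : j <= n ->
    \sum_(t < j) gain A t.+1 (window_of w Y t.+1) <= MIS j (window_of w Y j).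
  elim: j => [|j IH] jn; first by rewrite big_ord0.
  rewrite big_ord_recr /= MISE ?Ywin // addnC leq_add2l.
  have [_ _ maxp] := predP j.+1 _ jn (Ywin _ jn).
  apply: leq_trans (IH (ltnW jn)) (maxp _ _ _); first exact/Ywin/ltnW.
  exact: (@window_of_overlaps k n w Y j.+1).
rewrite -MISV //; apply: leq_trans (MISY _ (leqnn n)) _.
by rewrite VU //; apply: Umax; apply: Ywin.
Qed.

(** * Windows as numbers in base w + 1 *)

(** Stated for an arbitrary digit function, to serve both window codes in base [w + 1] and subsets
    of rows in base 2. *)
Lemma sum_digits_lt (b k : nat) (d : nat -> nat) :
  (forall i, i < k -> d i < b) -> \sum_(i < k) d i * b ^ i < b ^ k.
Proof.
elim: k => [|k IH] db; first by rewrite big_ord0.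
rewrite big_ord_recr /=.
have := IH (fun i ik => db i (leqW ik)).
have := db k (ltnSn k); move: (\sum_(i < k) _) => S dk Sk.
have : (d k).+1 * b ^ k <= b * b ^ k by rewrite leq_mul2r dk orbT.
by rewrite expnS mulSn; lia.
Qed.

Lemma digit_sum_digits (b k : nat) (d : nat -> nat) i :
  (forall i, i < k -> d i < b) -> i < k ->
  (\sum_(j < k) d j * b ^ j) %/ b ^ i %% b = d i.
Proof.
elim: k => [//|k IH] db ik; rewrite big_ord_recr /= addnC.
have db' i' : i' < k -> d i' < b by move=> h; apply/db/leqW.
have b0 : 0 < b by apply: leq_trans (db _ ik).
move: ik; rewrite ltnS leq_eqVlt => /predU1P[->|ik].
  rewrite divnMDl ?expn_gt0 ?b0 // divn_small ?addn0 ?modn_small ?db //.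
  exact: sum_digits_lt.
have -> : b ^ k = b ^ (k - i.+1) * b * b ^ i.
  by rewrite mulnAC -expnD -expnSr; congr (_ ^ _); lia.
by rewrite !mulnA divnMDl ?expn_gt0 ?b0 // modnMDl IH.
Qed.

Lemma sum_digits (b k c : nat) : 0 < b ->
  \sum_(i < k) (c %/ b ^ i %% b) * b ^ i = c %% b ^ k.
Proof.
move=> b0; elim: k => [|k IH]; first by rewrite big_ord0 modn1.
have bk : 0 < b ^ k by rewrite expn_gt0 b0.
rewrite big_ord_recr /= IH.
have E : c = c %/ b ^ k %/ b * b ^ k.+1 + (c %% b ^ k + c %/ b ^ k %% b * b ^ k)
    :> nat.
  rewrite [LHS](divn_eq c (b ^ k)) [in LHS](divn_eq (c %/ b ^ k) b) mulnDl.
  by rewrite -mulnA -expnS -addnA (addnC (_ * b ^ k)).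
rewrite [in RHS]E modnMDl [RHS]modn_small // expnS.
have : (c %/ b ^ k %% b).+1 * b ^ k <= b * b ^ k.
  by rewrite leq_mul2r ltn_mod b0 orbT.
by rewrite mulSn; have := ltn_pmod c bk; lia.
Qed.

Definition dig (w c i : nat) : nat := c %/ w.+1 ^ i %% w.+1.

Lemma dig_leq w c i : dig w c i <= w.
Proof. by rewrite -ltnS ltn_mod. Qed.

(** Extended by 0 to all naturals, so that it is a digit function in the sense of the lemmas on
    expansions. *)
Definition row_digit (k w : nat) (W : 'M[bool]_(k, w)) (i : nat) : nat :=
  if insub i : option 'I_k is Some i' then \sum_(p < w) W i' p * p.+1 else 0.

Lemma row_digitE (k w : nat) (W : 'M[bool]_(k, w)) (i : 'I_k) (p : 'I_w) :
  \sum_(p < w) W i p <= 1 ->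
  (row_digit W i == p.+1) = W i p.
Proof.
move/sum_bool_le1P=> W1; rewrite /row_digit valK.
case Wp: (W i p).
  rewrite (bigD1 p) //= Wp mul1n big1 ?addn0 ?eqxx // => q qp.
  case Wq: (W i q) => //; case/eqP: qp; exact: W1.
case: (pickP (W i)) => [q Wq|W0]; last by rewrite big1 // => q _; rewrite W0.
rewrite (bigD1 q) //= Wq mul1n big1 ?addn0.
  by apply/eqP => - [] qp; rewrite (_ : p = q) ?Wq // in Wp; apply: val_inj.
by move=> r rq; case Wr: (W i r) => //; case/eqP: rq; apply: W1.
Qed.

Lemma row_digit_leq (k w : nat) (W : 'M[bool]_(k, w)) (i : nat) :
  (forall i, \sum_(p < w) W i p <= 1) -> row_digit W i <= w.
Proof.
move=> W1; rewrite /row_digit; case: insubP => // i' _ _.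
case: (pickP (W i')) => [p Wp|W0]; last by rewrite big1 // => p _; rewrite W0.
by move: Wp; rewrite -row_digitE // /row_digit valK => /eqP->; apply: ltn_ord.
Qed.

Lemma encodeE (k w : nat) (W : 'M[bool]_(k, w)) :
  encode W = \sum_(i < k) row_digit W i * w.+1 ^ i.
Proof. by apply: eq_bigr => i _; rewrite /row_digit valK. Qed.

Lemma encode_lt (k w : nat) (W : 'M[bool]_(k, w)) :
  (forall i, \sum_(p < w) W i p <= 1) -> encode W < w.+1 ^ k.
Proof.
by move=> W1; rewrite encodeE; apply: sum_digits_lt => i _; apply: row_digit_leq.
Qed.

Lemma dig_encode (k w : nat) (W : 'M[bool]_(k, w)) (i : nat) :
  (forall i, \sum_(p < w) W i p <= 1) -> i < k ->
  dig w (encode W) i = row_digit W i.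
Proof.
move=> W1 ik; rewrite encodeE /dig digit_sum_digits // => i' _.
exact: row_digit_leq.
Qed.

Lemma decodeE (k w c : nat) i p : decode k w c i p = (dig w c i == p.+1).
Proof. by rewrite mxE. Qed.

Lemma encodeK (k w : nat) (W : 'M[bool]_(k, w)) :
  (forall i, \sum_(p < w) W i p <= 1) -> decode k w (encode W) = W.
Proof.
by move=> W1; apply/matrixP => i p; rewrite decodeE dig_encode // row_digitE.
Qed.

Lemma decode_row (k w c : nat) (i : 'I_k) : \sum_(p < w) decode k w c i p <= 1.
Proof.
apply/sum_bool_le1P => p q _ _; rewrite !decodeE => /eqP-> /eqP[] pq.
exact: val_inj.
Qed.

Lemma row_digit_decode (k w c : nat) (i : 'I_k) :
  row_digit (decode k w c) i = dig w c i.
Proof.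
case E: (dig w c i) => [|p].
  rewrite /row_digit valK big1 // => p _.
  by rewrite decodeE E.
have pw : p < w by rewrite -E dig_leq.
apply/eqP; have /= <- := esym (@row_digitE _ _ _ i (Ordinal pw) (decode_row w c i)).
by rewrite decodeE E.
Qed.

Lemma decodeK (k w c : nat) : c < w.+1 ^ k -> encode (decode k w c) = c.
Proof.
move=> cN; rewrite encodeE -[RHS](modn_small cN) -sum_digits //.
by apply: eq_bigr => i _; rewrite row_digit_decode.
Qed.

(** * Membership tests on codes *)

Definition code_feasible (k l w c : nat) : bool :=
  all (fun i => \sum_(i' < k) ((0 < dig w c i) && (dig w c i == dig w c i')) <= l)
      (iota 0 k).

(** A digit [p.+1] stands for column [p], whose time [j - w + 1 + p] is stored at index [j + p];
    hence the [- 1]. *)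
Definition code_window (k l w : nat) (G : nat -> nat -> nat) (j c : nat) : bool :=
  code_feasible k l w c &&
  all (fun i => (0 < dig w c i) ==> (G i (j + dig w c i - 1) != 0)) (iota 0 k).

Lemma all_iotaP (k : nat) (P : pred nat) :
  reflect (forall i : 'I_k, P i) (all P (iota 0 k)).
Proof.
apply: (iffP allP) => [h i|h i].
  by apply: h; rewrite mem_iota /=.
by rewrite mem_iota /= => ik; apply: (h (Ordinal ik)).
Qed.

(** A column without ones satisfies the capacity trivially, and any other column is the column of
    the one of some row; comparing each row with all rows therefore tests every column. *)
Lemma code_feasibleE (k l w c : nat) :
  feasible_window l (decode k w c) = code_feasible k l w c.
Proof.
rewrite /feasible_window; have -> /= :
    [forall i, \sum_(p < w) decode k w c i p <= 1].
  by apply/forallP => i; apply: decode_row.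
apply/forallP/all_iotaP => [h i|h p].
  case E: (dig w c i) => [|p]; first by rewrite big1.
  have pw : p < w by rewrite -E dig_leq.
  apply: leq_trans (h (Ordinal pw)); apply: leq_sum => i' _.
  by rewrite decodeE /= eq_sym.
case: (pickP (fun i : 'I_k => decode k w c i p)) => [i|W0].
  rewrite decodeE => /eqP E; apply: leq_trans (h i); apply: leq_sum => i' _.
  by rewrite decodeE E /= eq_sym.
by rewrite big1 // => i _; rewrite W0.
Qed.

Definition stored (k n w : nat) (A : 'M[bool]_(k, n)) (G : nat -> nat -> nat) :=
  forall (i : 'I_k) (c : nat), c < n + w ->
    G i c = padded A i (Posz c - Posz w + 1)%R.

(** The bound [j <= n] keeps every index [j + p] with [p < w] inside the stored range. *)
Lemma code_windowE (k n l w c j : nat) (A : 'M[bool]_(k, n)) G :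
  stored w A G -> j <= n ->
  (decode k w c \in windows l w A j) = code_window k l w G j c.
Proof.
move=> GA jn; rewrite inE code_feasibleE andbC; congr (_ && _).
have GE (i : 'I_k) (p : 'I_w) :
    (G i (j + p.+1 - 1) != 0) = padded A i (window_time w j p).
  have pw := ltn_ord p; rewrite GA; last lia.
  have -> : (Posz (j + p.+1 - 1) - Posz w + 1)%R = window_time w j p.
    by rewrite /window_time; lia.
  by case: padded.
apply/'forall_forallP/all_iotaP => [h i|h i p].
  case E: (dig w c i) => [//|p] /=.
  have pw : p < w by rewrite -E dig_leq.
  by rewrite (GE i (Ordinal pw)); have := h i (Ordinal pw); rewrite decodeE E eqxx.
by rewrite decodeE; apply/implyP => /eqP E; have := h i; rewrite E /= GE.
Qed.

(** * Predecessors of a coded window *)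

(** Here [x] is the digit of the later window and [b] the bit of the first column of the earlier
    one. A one before the last column was one column further right in the earlier window, whence
    [x.+1]; a zero row, or a one in the last column, leaves only the first column free. The value 0
    is a placeholder for the conflict that [pred_valid] excludes. *)
Definition pred_digit (w x b : nat) : nat :=
  if (x == 0) || (x == w) then b else if b != 0 then 0 else x.+1.

Definition pred_code (k w c m : nat) : nat :=
  \sum_(i < k) pred_digit w (dig w c i) (m %/ 2 ^ i %% 2) * w.+1 ^ i.

Definition pred_valid (k w c m : nat) : bool :=
  all (fun i => [|| dig w c i == 0, dig w c i == w | m %/ 2 ^ i %% 2 == 0])
      (iota 0 k).

Lemma pred_digit_leq w c i m : 0 < w ->
  pred_digit w (dig w c i) (m %/ 2 ^ i %% 2) <= w.
Proof.
move=> w0; rewrite /pred_digit; have : m %/ 2 ^ i %% 2 < 2 by rewrite ltn_mod.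
move: (dig w c i) (dig_leq w c i) (_ %% 2) => x xw b.
by case: ifP => [|xw']; [lia | case: ifP; lia].
Qed.

Lemma pred_code_lt k w c m : 0 < w -> pred_code k w c m < w.+1 ^ k.
Proof.
move=> w0.
by apply: (@sum_digits_lt _ _ (fun i => pred_digit w (dig w c i) (m %/ 2 ^ i %% 2)))
  => i _; apply: pred_digit_leq.
Qed.

Lemma dig_pred_code k w c m i : 0 < w -> i < k ->
  dig w (pred_code k w c m) i = pred_digit w (dig w c i) (m %/ 2 ^ i %% 2).
Proof.
move=> w0 ik.
apply: (@digit_sum_digits _ _ (fun i => pred_digit w (dig w c i) (m %/ 2 ^ i %% 2)))
  => // i' _; exact: pred_digit_leq.
Qed.

Lemma pred_code_overlaps (k w c m : nat) : 0 < w -> pred_valid k w c m ->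
  overlaps (decode k w (pred_code k w c m)) (decode k w c).
Proof.
move=> w0 /all_iotaP val_m; apply/'forall_forallP => i p; apply/forallP => q.
apply/implyP => /eqP pq; rewrite !decodeE dig_pred_code // /pred_digit pq.
have : m %/ 2 ^ i %% 2 < 2 by rewrite ltn_mod.
have := val_m i; have := ltn_ord p; have := dig_leq w c i; rewrite pq.
case: (dig w c i) => [|x] /=; first by case: (_ %% 2) => [|[]].
case: (eqVneq x.+1 w) => [->|_] /=; last by move=> _ _ /eqP->.
case: (_ %% 2) => [|[]] // _ qw _ _; rewrite ?eqSS; apply/eqP; apply/esym/negbTE;
  apply/eqP; lia.
Qed.

(** Overlap determines every column of [W] but the first, so the first column, read as a binary
    number, recovers [W]. *)
Lemma pred_code_complete (k w c : nat) (W : 'M[bool]_(k, w)) : 0 < w ->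
  (forall i, \sum_(p < w) W i p <= 1) -> overlaps W (decode k w c) ->
  exists2 m, m < 2 ^ k & pred_valid k w c m /\ pred_code k w c m = encode W.
Proof.
move=> w0 W1 ov.
(* Digit 1 of a row of [W] means a one in its first column. *)
pose m := \sum_(i < k) (row_digit W i == 1) * 2 ^ i.
have bitm i : i < k -> m %/ 2 ^ i %% 2 = (row_digit W i == 1).
  move=> ik; apply: (@digit_sum_digits 2 k (fun i => row_digit W i == 1)) => //.
  by move=> i' _; case: (_ == _).
have shift (i : 'I_k) q : q.+1 < w ->
    (row_digit W i == q.+2) = (dig w c i == q.+1).
  move=> qw; move/'forall_forallP: ov => /(_ i (Ordinal qw))/forallP.
  move=> /(_ (Ordinal (ltnW qw))); rewrite eqxx decodeE -row_digitE //=.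
  by move/eqP.
exists m; first by apply: (@sum_digits_lt 2 k (fun i => row_digit W i == 1))
  => i _; case: (_ == _).
split.
  apply/all_iotaP => i; rewrite bitm //; case: (eqVneq (dig w c i) 0) => //= x0.
  case: (eqVneq (dig w c i) w) => //= xw; have := dig_leq w c i => xlw.
  have := shift i (dig w c i).-1; rewrite prednK ?lt0n // eqxx.
  by rewrite ltn_neqAle xw xlw => /(_ isT)/eqP->; rewrite eqSS (negbTE x0).
rewrite encodeE; apply: eq_bigr => i _; congr (_ * _).
rewrite bitm // /pred_digit; have xlw := dig_leq w c i.
have dlw := row_digit_leq i W1.
(* If the later digit is 0 or [w], the digit of [W] cannot exceed 1: a digit [q.+2] would force the
   later digit [q.+1], which is positive and below [w]. *)
case: ifP => [/orP x0w|/norP[x0 xw]].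
  case E: (row_digit W i) dlw => [|[|q]] //= qw.
  have := shift i q qw; rewrite E eqxx => /esym/eqP Ex.
  by rewrite Ex in x0w; case: x0w => /eqP; lia.
have := shift i (dig w c i).-1; rewrite prednK ?lt0n // eqxx.
by rewrite ltn_neqAle xw xlw => /(_ isT)/eqP->; rewrite eqSS (negbTE x0).
Qed.

(** An empty first column never conflicts. The remaining ones keep their times and their columns are
    among those of the given window, so availability and capacity are inherited. Hence every search
    for a predecessor succeeds. *)
Lemma pred_code0 (k l w c j : nat) G : 0 < w -> 0 < j ->
  code_window k l w G j c ->
  pred_valid k w c 0 /\ code_window k l w G j.-1 (pred_code k w c 0).
Proof.
move=> w0 j0 /andP[/all_iotaP cap /all_iotaP avail]; split.
  by apply/all_iotaP => i; rewrite div0n mod0n eqxx !orbT.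
apply/andP; split; apply/all_iotaP => i.
  apply: leq_trans (cap i); apply: leq_sum => i' _.
  rewrite !dig_pred_code // /pred_digit !div0n !mod0n /=.
  do 2 case: ifP => //=; rewrite ?eqSS.
  by move=> _ /norP[+ _]; rewrite -lt0n => ->.
have := avail i; rewrite dig_pred_code // /pred_digit div0n mod0n /=.
case: ifP => //= /norP[x0 _]; rewrite lt0n x0 /=.
by rewrite (_ : j.-1 + _ - 1 = j + dig w c i - 1); last lia.
Qed.

(** * Frames, loop invariants and running times *)

Fixpoint writes (c : com) (x : var) : bool :=
  match c with
  | Skip => false
  | Assign y _ _ _ => var_beq y x
  | Seq c1 c2 => writes c1 x || writes c2 x
  | If _ c1 c2 => writes c1 x || writes c2 x
  | For y _ c1 => var_beq y x || writes c1 x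
  end.

Fixpoint reads (e : exp) (x : var) : bool :=
  match e with
  | Defs.Num _ => false
  | Cell y e1 e2 => [|| var_beq y x, reads e1 x | reads e2 x]
  | Bin _ e1 e2 => reads e1 x || reads e2 x
  end.

(** Not restricted to [s' = exec c s]: the states met inside [c] are compared with its initial state
    by the same relation. *)
Definition frame (c : com) (s s' : state) : Prop :=
  forall x, ~~ writes c x -> forall a b, s' x a b = s x a b.

Lemma upd_other s x a b v y : ~~ var_beq x y ->
  forall a' b', upd s x a b v y a' b' = s y a' b'.
Proof. by rewrite /upd => /negbTE->. Qed.

Lemma exec_frame c s : frame c s (exec c s).
Proof.
elim: c s => [|y e1 e2 e|c1 IH1 c2 IH2|e c1 IH1 c2 IH2|y e c1 IH] s x //=.
- by move=> yx a b; rewrite upd_other.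
- by rewrite negb_or => /andP[n1 n2] a b; rewrite IH2 // IH1.
- by rewrite negb_or => /andP[n1 n2] a b; case: ifP => _; rewrite ?IH1 ?IH2.
- rewrite negb_or => /andP[n1 n2] a b.
  by elim: (eval e s) => //= v IHv; rewrite IH // upd_other.
Qed.

Lemma eval_agree e s s' :
  (forall x, reads e x -> forall a b, s' x a b = s x a b) -> eval e s' = eval e s.
Proof.
elim: e => [//|y e1 IH1 e2 IH2|o e1 IH1 e2 IH2] /= h.
  rewrite IH1 ?IH2 ?h //; first by case: y h => h /=.
  - by move=> x r; apply: h; rewrite r !orbT.
  - by move=> x r; apply: h; rewrite r !orbT.
by rewrite IH1 ?IH2 // => x r; apply: h; rewrite r ?orbT.
Qed.

Lemma eval_frame c e s s' : frame c s s' ->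
  (forall x, reads e x -> ~~ writes c x) -> eval e s' = eval e s.
Proof. by move=> cs ec; apply: eval_agree => x /ec /cs. Qed.

Lemma exec_Seq c1 c2 s : exec (Seq c1 c2) s = exec c2 (exec c1 s).
Proof. by []. Qed.

Lemma exec_If e c1 c2 s :
  exec (If e c1 c2) s = if eval e s != 0 then exec c1 s else exec c2 s.
Proof. by []. Qed.

Lemma exec_Assign x e1 e2 e s :
  exec (Assign x e1 e2 e) s = upd s x (eval e1 s) (eval e2 s) (eval e s).
Proof. by []. Qed.

(** Invariant rule for loops. The invariant must ignore the loop variable, which is overwritten
    before each pass; the body may use that this variable holds [v] and that unwritten variables are
    as at loop entry. *)
Lemma for_ind (I : nat -> state -> Prop) x e c s N :
  eval e s = N -> I 0 s -> (forall v u s', I v s' -> I v (upd s' x 0 0 u)) ->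
  (forall v s', v < N -> frame (For x e c) s s' -> s' x 0 0 = v ->
     I v s' -> I v.+1 (exec c s')) ->
  I N (exec (For x e c) s).
Proof.
move=> /= -> I0 Iupd IS.
have : forall v, v <= N ->
    let s' := iteri v (fun v s' => exec c (upd s' x 0 0 v)) s in
    frame (For x e c) s s' /\ I v s'; last by move=> /(_ N (leqnn N)) [].
elim=> [//|v IH] ltv /=; have [Fv Iv] := IH (ltnW ltv).
set s' := iteri v _ s in Fv Iv *.
have F1 : frame (For x e c) s (upd s' x 0 0 v).
  move=> y ny a b; rewrite -Fv // upd_other //.
  by move: ny; rewrite /= negb_or => /andP[].
split; last by apply: IS => //; [rewrite /upd /=; case: (x) | apply: Iupd].
move=> y ny a b; rewrite exec_frame ?F1 //.
by move: ny; rewrite /= negb_or => /andP[].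
Qed.

(** * Upper bounds on running times *)

(** [L] estimates loop lengths from the bounding expressions; a conditional is charged for both
    branches, which makes the result independent of the state. *)
Fixpoint bound (L : exp -> nat) (c : com) : nat :=
  match c with
  | Skip => 1
  | Assign _ e1 e2 e => (exp_time e1 + exp_time e2 + exp_time e).+1
  | Seq c1 c2 => bound L c1 + bound L c2
  | If e c1 c2 => (exp_time e + (bound L c1 + bound L c2)).+1
  | For _ e c1 => (exp_time e + L e * (bound L c1).+1).+1
  end.

(** [P] marks protected variables. When [Q] depends on these only, it survives every command, so the
    estimates hold whenever a loop is entered. *)
Fixpoint loops_bounded (P : pred var) (Q : state -> Prop) (L : exp -> nat) (c : com) :
    Prop :=
  match c with
  | Skip => True
  | Assign x _ _ _ => ~~ P x
  | Seq c1 c2 => loops_bounded P Q L c1 /\ loops_bounded P Q L c2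
  | If _ c1 c2 => loops_bounded P Q L c1 /\ loops_bounded P Q L c2
  | For x e c1 =>
      [/\ ~~ P x, forall s, Q s -> eval e s <= L e & loops_bounded P Q L c1]
  end.

Lemma var_beqP x y : reflect (x = y) (var_beq x y).
Proof. by apply: (iffP idP) => [/internal_var_dec_bl | /internal_var_dec_lb]. Qed.

Lemma loops_bounded_writes P Q L c x :
  loops_bounded P Q L c -> P x -> ~~ writes c x.
Proof.
move=> + Px; elim: c => [|y e1 e2 e|c1 IH1 c2 IH2|e c1 IH1 c2 IH2|y e c1 IH] //=.
- by apply: contra => /var_beqP->.
- by case=> /IH1/negbTE-> /IH2.
- by case=> /IH1/negbTE-> /IH2.
- case=> Py _ /IH/negbTE->; rewrite orbF; apply: contra Py.
  by move/var_beqP->.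
Qed.

Lemma time_bound (P : pred var) (Q : state -> Prop) L c s :
  (forall s s', (forall x, P x -> forall a b, s' x a b = s x a b) -> Q s -> Q s') ->
  loops_bounded P Q L c -> Q s -> time c s <= bound L c.
Proof.
move=> QP; elim: c s => [|y e1 e2 e|c1 IH1 c2 IH2|e c1 IH1 c2 IH2|y e c1 IH] s //=.
- case=> st1 st2 Qs; apply: leq_add; first exact: IH1.
  apply: IH2 => //; apply: QP Qs => x Px a b.
  by rewrite exec_frame // (loops_bounded_writes st1).
- case=> st1 st2 Qs; rewrite ltnS leq_add2l; case: ifP => _.
    exact: leq_trans (IH1 _ st1 Qs) (leq_addr _ _).
  exact: leq_trans (IH2 _ st2 Qs) (leq_addl _ _).
- case=> Py Le st Qs; rewrite ltnS leq_add2l.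
  apply: (@leq_trans (eval e s * (bound L c1).+1)); last by rewrite leq_mul2r Le ?orbT.
  rewrite -[X in _ <= X * _]card_ord -sum_nat_const; apply: leq_sum => v _.
  rewrite ltnS; apply: IH => //; apply: QP Qs => x Px a b.
  have yx : ~~ var_beq y x by apply: contra Py => /var_beqP->.
  rewrite upd_other //; elim: (v : nat) => //= u IHu.
  by rewrite exec_frame ?upd_other // (loops_bounded_writes st).
Qed.

(** * Correctness of the program *)

Definition constant_var (x : var) : bool :=
  match x with vk | vl | vn | vw | vG | vPOW | vTWO => true | _ => false end.

Record env (k l n w : nat) (G : nat -> nat -> nat) (s : state) : Prop := Env {
  env_k : s vk 0 0 = k;
  env_l : s vl 0 0 = l;
  env_n : s vn 0 0 = n;
  env_w : s vw 0 0 = w;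
  env_G : forall i c, s vG i c = G i c;
  env_pow : forall i, i <= k -> s vPOW i 0 = w.+1 ^ i;
  env_two : forall i, i <= k -> s vTWO i 0 = 2 ^ i
}.

Section Subprograms.

Variables (k l n w : nat) (G : nat -> nat -> nat).
Local Notation env := (env k l n w G).

Lemma env_agree s s' :
  (forall x, constant_var x -> forall a b, s' x a b = s x a b) -> env s -> env s'.
Proof. by move=> F [*]; split=> *; rewrite F //; auto. Qed.

Lemma env_frame c s s' : frame c s s' ->
  (forall x, constant_var x -> ~~ writes c x) -> env s -> env s'.
Proof. by move=> F h; apply: env_agree => x cx; apply: F; apply: h. Qed.

(** The code is an expression evaluated anew inside the loops, so it must not read what the command
    writes. *)
Lemma check_feasible_spec e s : env s ->
  (forall x, reads e x -> ~~ writes (check_feasible e) x) ->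
  (exec (check_feasible e) s vOK 0 0 != 0) = code_feasible k l w (eval e s).
Proof.
move=> E re; rewrite exec_Seq exec_Assign.
set s0 := upd _ _ _ _ _.
have F0 : frame (check_feasible e) s s0.
  by move=> x nx a b; apply: upd_other; case: x nx.
have ek : eval vk s0 = k by rewrite /= F0 ?(env_k E).
pose f i i' : nat :=
  (0 < dig w (eval e s) i) && (dig w (eval e s) i == dig w (eval e s) i').
pose g i := \sum_(i' < k) f i i' <= l.
apply: (for_ind (I := fun v s' => (s' vOK 0 0 != 0) = all g (iota 0 v)) ek) => //.
move=> v s1 vk1 F1 s1i I1.
have {}F1 : frame (check_feasible e) s s1.
  by move=> x nx a b; rewrite F1 ?F0 //; case: x nx.
rewrite exec_Seq exec_Seq exec_Assign; set s2 := upd _ _ _ _ _.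
have F2 : frame (check_feasible e) s s2.
  by move=> x nx a b; rewrite -F1 //; apply: upd_other; case: x nx.
set s3 := exec _ s2.
have F3 : frame (check_feasible e) s s3.
  by move=> x nx a b; rewrite -F2 // /s3 exec_frame //; case: x nx.
have cnt : s3 vcnt 0 0 = \sum_(i' < k) f v i'.
  have e2k : eval vk s2 = k by rewrite /= F2 ?(env_k E).
  apply: (for_ind (I := fun v' s' => s' vcnt 0 0 = \sum_(i' < v') f v i') e2k) => //.
    by rewrite big_ord0.
  move=> v' s4 v'k F4 s4i I4.
  have s4v : s4 vi 0 0 = v by rewrite F4.
  have {}F4 : frame (check_feasible e) s s4.
    by move=> x nx a b; rewrite -F2 // F4 //; case: x nx.
  have E4 : env s4 by apply: env_frame F4 _ E; case.
  have e4 : eval e s4 = eval e s by apply: eval_frame F4 re.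
  have [v'k1 vk2] := (ltnW v'k, ltnW vk1).
  rewrite exec_If /= s4i s4v (env_w E4) !(env_pow E4) // addn1 e4.
  rewrite -!/(dig _ _ _).
  rewrite big_ord_recr /= -I4 /f muln_eq0 !eqb0 negb_or !negbK.
  by case: ifP => _ //=; rewrite ?addn0.
have ok3 : s3 vOK 0 0 = s1 vOK 0 0 by rewrite /s3 exec_frame.
rewrite exec_If -[v.+1]addn1 iotaD all_cat -I1 /= andbT cnt F3 // (env_l E).
rewrite add0n eqb0 negbK /g; case: ifP => _; rewrite ?andbT ?andbF /= ?ok3 //.
Qed.

Lemma check_window_spec j e s : env s ->
  (forall x, reads j x || reads e x -> ~~ writes (check_window j e) x) ->
  (exec (check_window j e) s vOK 0 0 != 0) = code_window k l w G (eval j s) (eval e s).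
Proof.
move=> E re; rewrite exec_Seq; set s0 := exec _ s.
have F0 : frame (check_window j e) s s0.
  by move=> x nx a b; apply: exec_frame; case: x nx.
have ok0 : (s0 vOK 0 0 != 0) = code_feasible k l w (eval e s).
  apply: check_feasible_spec => // x rx.
  by have := re x; rewrite rx orbT => /(_ isT); case: (x).
have ek : eval vk s0 = k by rewrite /= F0 ?(env_k E).
pose g i := (0 < dig w (eval e s) i) ==> (G i (eval j s + dig w (eval e s) i - 1) != 0).
rewrite /code_window -/g; set feas := code_feasible _ _ _ _ in ok0 *.
apply: (for_ind (I := fun v s' => (s' vOK 0 0 != 0) = feas && all g (iota 0 v)) ek) => //.
  by rewrite andbT.
move=> v s1 vk1 F1 s1i I1.
have {}F1 : frame (check_window j e) s s1.
  by move=> x nx a b; rewrite -F0 // F1 //; case: x nx.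
have E1 : env s1 by apply: env_frame F1 _ E; case.
have e1 : eval e s1 = eval e s.
  by apply: eval_frame F1 _ => x rx; apply: re; rewrite rx orbT.
have j1 : eval j s1 = eval j s.
  by apply: eval_frame F1 _ => x rx; apply: re; rewrite rx.
rewrite -[v.+1]addn1 iotaD all_cat andbA -I1 /= andbT.
have vk2 := ltnW vk1.
rewrite /g s1i (env_w E1) !(env_pow E1) // e1 j1 (env_G E1) add0n addn1 -!/(dig _ _ _).
rewrite eqb0 negbK; case: ifP => _ //=; last by rewrite andbT.
by rewrite muln_eq0 negb_or.
Qed.

Lemma make_predecessor_spec s : env s ->
  exec make_predecessor s vd 0 0 = pred_code k w (s vc 0 0) (s vm 0 0) /\
  (exec make_predecessor s vVALID 0 0 != 0) = pred_valid k w (s vc 0 0) (s vm 0 0).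
Proof.
move=> E; rewrite 2!exec_Seq !exec_Assign.
set s0 := upd _ _ _ _ _.
have F0 : frame make_predecessor s s0.
  by move=> x nx a b; rewrite /s0 !upd_other //; case: x nx.
have ek : eval vk s0 = k by rewrite /= F0 ?(env_k E).
apply: (for_ind (I := fun v s' => s' vd 0 0 = pred_code v w (s vc 0 0) (s vm 0 0) /\
   (s' vVALID 0 0 != 0) = pred_valid v w (s vc 0 0) (s vm 0 0)) ek) => //.
  by rewrite /pred_code big_ord0.
move=> v s1 vk1 F1 s1i [I1 J1].
have {}F1 : frame make_predecessor s s1.
  by move=> x nx a b; rewrite -F0 // F1 //; case: x nx.
have E1 : env s1 by apply: env_frame F1 _ E; case.
rewrite /pred_code /pred_valid -[v.+1]addn1 iotaD all_cat -/(pred_valid _ _ _ _) -J1.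
rewrite addn1 big_ord_recr -/(pred_code _ _ _ _) /= /upd /= andbT add0n -I1.
have vk2 := ltnW vk1.
rewrite s1i (env_w E1) (env_two E1) // !(env_pow E1) // (F1 vc) // (F1 vm) // addn1.
rewrite -!/(dig w _ _).
rewrite /pred_digit; move: (dig _ _ _) (_ %% 2) => x b.
have -> : ((x == 0) + (x == w) != 0) = (x == 0) || (x == w).
  by case: (x == 0); case: (x == w).
rewrite orbA; case: ifP => _; first by rewrite /= andbT.
by case: eqVneq => [->|b0] /=; rewrite ?andbT ?andbF ?addn1 ?addn0.
Qed.

(** [vFOUND] separates the empty search, where [vARG] and [vBEST] hold stale values, from a best
    entry equal to 0. The candidate set is a parameter because the search for predecessors and the
    final retrieval share it. *)
Definition best (mis : nat -> nat) (cand : nat -> Prop) (s : state) : Prop :=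
  if s vFOUND 0 0 == 0 then forall d, ~ cand d
  else [/\ cand (s vARG 0 0), s vBEST 0 0 = mis (s vARG 0 0)
         & forall d, cand d -> mis d <= mis (s vARG 0 0)].

Lemma best_ext mis cand cand' s s' :
  s' vFOUND 0 0 = s vFOUND 0 0 -> s' vBEST 0 0 = s vBEST 0 0 ->
  s' vARG 0 0 = s vARG 0 0 -> (forall d, cand d <-> cand' d) ->
  best mis cand s -> best mis cand' s'.
Proof.
rewrite /best => -> -> -> h; case: ifP => _.
  by move=> H d /h /H.
by move=> [/h H1 H2 H3]; split=> // d /h /H3.
Qed.

Lemma keep_best_spec j e s mis cand :
  s vMIS (eval j s) (eval e s) = mis (eval e s) ->
  (forall x, reads j x || reads e x -> ~~ writes (keep_best j e) x) ->
  best mis cand s ->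
  best mis (fun d => cand d \/ d = eval e s) (exec (keep_best j e) s).
Proof.
move=> me re; rewrite /best exec_If.
have -> : (eval ((vFOUND == 0) + (vBEST + 1 <= vMIS@[j, e]))%ram s != 0) =
    (s vFOUND 0 0 == 0) || (s vBEST 0 0 < mis (eval e s)).
  by rewrite /= me addn1 addn_eq0 !eqb0 negb_and !negbK.
case: (boolP (_ || _)) => [new|/norP[/negbTE F0 old]]; last first.
  rewrite /= F0 => - [cA bA maxA].
  split; [by left | by [] |].
  by move=> d [/maxA //|->]; rewrite leqNgt -bA.
have ev x e' v : (forall y, reads e' y -> ~~ writes (keep_best j e) y) ->
    writes (keep_best j e) x -> forall s1, eval e' (upd s1 x 0 0 v) = eval e' s1.
  move=> re' wx s1; apply: eval_agree => y /re' ry a b; apply: upd_other.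
  by apply: contra ry => /var_beqP<-.
have rj y : reads j y -> ~~ writes (keep_best j e) y by move=> h; apply: re; rewrite h.
have re1 y : reads e y -> ~~ writes (keep_best j e) y.
  by move=> h; apply: re; rewrite h orbT.
rewrite !exec_Seq !exec_Assign [eval 0 _]/= [eval 1 _]/= /upd /= -/(upd s vFOUND 0 0 1).
have e1 : eval e (upd s vFOUND 0 0 1) = eval e s by apply: ev.
have j1 : eval j (upd s vFOUND 0 0 1) = eval j s by apply: ev.
have e2 v : eval e (upd (upd s vFOUND 0 0 1) vBEST 0 0 v) = eval e s.
  by rewrite ev.
rewrite -/(upd (upd s vFOUND 0 0 1) vBEST 0 0 _) e2 e1 j1 me => H.
split; [by right | by [] |].
move=> d [cd|->//]; move: new H; case: eqVneq => [_ _ /(_ d)//|_ /= lt [_ bA maxA]].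
by apply: leq_trans (maxA _ cd) _; rewrite -bA ltnW.
Qed.

Hypothesis w_gt0 : 0 < w.

Definition code_gain (j c : nat) : nat :=
  \sum_(i < k) (dig w c i == w) * G i (j + w - 1).

(** Maximality over the subsets of rows, the form in which the program enumerates predecessors;
    completeness of this enumeration turns it into maximality over all overlapping windows. *)
Definition best_pred (mis : nat -> nat) (j c a : nat) : Prop :=
  [/\ exists2 m, m < 2 ^ k & pred_valid k w c m /\ a = pred_code k w c m,
      code_window k l w G j.-1 a
    & forall m, m < 2 ^ k -> pred_valid k w c m ->
        code_window k l w G j.-1 (pred_code k w c m) ->
        mis (pred_code k w c m) <= mis a].

(* [main_loop] is convertible to its two outer loops around [cell], whose guarded
   part is [update_cell]. *)
Definition update_cell : com := (
  vFOUND <~ 0;;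
  For vm vTWO@[vk, 0] (
    make_predecessor;;
    If vVALID (
      check_window (vj - 1) vd;;
      If vOK (keep_best (vj - 1) vd) Skip) Skip);;
  vGAIN <~ 0;;
  For vi vk (
    vGAIN <~ vGAIN + (digit vc vi == vw) * vG@[vi, vj + vw - 1]);;
  vMIS <~[vj, vc] vGAIN + vMIS@[vj - 1, vARG];;
  vPRED <~[vj, vc] vARG)%ram.

Lemma update_cell_spec s j c : env s -> s vj 0 0 = j -> s vc 0 0 = c ->
  0 < j -> code_window k l w G j c ->
  let s' := exec update_cell s in
  exists2 a, best_pred (s vMIS j.-1) j c a &
    (forall y z, s' vMIS y z =
       if (j == y) && (c == z) then code_gain j c + s vMIS j.-1 a else s vMIS y z) /\
    (forall y z, s' vPRED y z = if (j == y) && (c == z) then a else s vPRED y z).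
Proof.
move=> E sj sc j0 win; rewrite /update_cell 5!exec_Seq.
set s0 := exec (vFOUND <~ 0)%ram s.
have F0 : frame update_cell s s0.
  by move=> x nx a b; apply: exec_frame; case: x nx.
have MP0 x : [|| var_beq x vMIS, var_beq x vPRED, var_beq x vj | var_beq x vc] ->
    forall a b, s0 x a b = s x a b.
  by case: x.
set s1 := exec _ s0.
pose cand v d := exists m, [/\ m < v, pred_valid k w c m, d = pred_code k w c m
  & code_window k l w G j.-1 d].
have B1 : best (s vMIS j.-1) (cand (2 ^ k)) s1.
  have e2 : eval vTWO@[vk, 0]%ram s0 = 2 ^ k.
    by rewrite /= !F0 // (env_k E) (env_two E).
  apply: (for_ind (I := fun v => best (s vMIS j.-1) (cand v)) e2) => //.
    by move=> d [m []].
  move=> v s2 vk2 F2 s2m B2.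
  have E2 : env s2.
    by apply: env_frame F2 _ (env_frame F0 _ E); case.
  have [] := make_predecessor_spec E2.
  have -> : s2 vc 0 0 = c by rewrite F2.
  rewrite s2m exec_Seq; set s3 := exec make_predecessor s2 => d3 v3.
  have F3 : frame make_predecessor s2 s3 by apply: exec_frame.
  have E3 : env s3 by apply: env_frame F3 _ E2; case.
  have c3 x : [|| var_beq x vMIS, var_beq x vPRED, var_beq x vj | var_beq x vc] ->
      forall a b, s3 x a b = s x a b.
    by move=> hx a b; rewrite F3 ?F2 ?MP0 //; case: x hx.
  rewrite exec_If [eval vVALID s3]/= v3.
  (* A subset that conflicts, or yields a window outside the family, adds no candidate. *)
  have skip s' : frame (check_window (vj - 1)%ram vd) s3 s' ->
      pred_valid k w c v && code_window k l w G j.-1 (pred_code k w c v) = false ->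
      best (s vMIS j.-1) (cand v.+1) s'.
    move=> F' bad; apply: best_ext B2; try by rewrite F' ?F3.
    move=> d; split=> - [m [mv vm dm wm]]; exists m; split=> //; first exact: leqW.
    move: mv; rewrite ltnS leq_eqVlt => /predU1P[mv|//].
    by move: bad; rewrite -mv vm -dm wm.
  case: (boolP (pred_valid k w c v)) => val; last by apply: skip; rewrite ?(negbTE val).
  rewrite exec_Seq; set s4 := exec (check_window (vj - 1)%ram vd) s3.
  have F4 : frame (check_window (vj - 1)%ram vd) s3 s4 by apply: exec_frame.
  have ok4 : (s4 vOK 0 0 != 0) = code_window k l w G j.-1 (pred_code k w c v).
    rewrite check_window_spec //; last by case.
    by rewrite /= d3 c3 // sj subn1.
  rewrite exec_If [eval vOK s4]/= ok4.
  case: ifP => win4; last by apply: skip; rewrite ?val ?win4.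
  have ed4 : eval vd s4 = pred_code k w c v by rewrite /= F4.
  have ej4 : eval (vj - 1)%ram s4 = j.-1 by rewrite /= F4 // c3 // sj subn1.
  have := @keep_best_spec (vj - 1)%ram vd s4 (s vMIS j.-1) (cand v).
  rewrite ed4 ej4 => H.
  have {}H := H _ _ _.
  apply: best_ext (H _ _ _) => //.
  - move=> d; split=> [[[m [mv vm dm wm]]|->]|[m [mv vm dm wm]]].
    + by exists m; split=> //; apply: leqW.
    + by exists v; split.
    + move: mv; rewrite ltnS leq_eqVlt => /predU1P[mv|mv].
        by right; rewrite dm mv.
      by left; exists m.
  - by rewrite F4 // c3.
  - by case.
  - by apply: best_ext B2; rewrite ?F4 ?F3.
have F1 : frame update_cell s s1.
  by move=> x nx a b; rewrite -F0 // /s1 exec_frame //; case: x nx.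
have MP1 x : [|| var_beq x vMIS, var_beq x vPRED, var_beq x vj | var_beq x vc] ->
    forall a b, s1 x a b = s x a b.
  by move=> hx a b; rewrite /s1 exec_frame ?MP0 //; case: x hx.
set s2 := exec (vGAIN <~ 0)%ram s1; set s3 := exec (For _ _ _) s2.
have g3 : s3 vGAIN 0 0 = code_gain j c.
  have e2 : eval vk s2 = k by rewrite /= -(env_k E) -F1.
  pose f i := (dig w c i == w) * G i (j + w - 1).
  apply: (for_ind (I := fun v s' => s' vGAIN 0 0 = \sum_(i < v) f i) e2) => //.
    by rewrite big_ord0.
  move=> v s4 vk4 F4 s4i I4.
  have F4' : frame update_cell s s4.
    by move=> x nx a b; rewrite F4 -?F1 //; case: x nx.
  have E4 : env s4 by apply: env_frame F4' _ E; case.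
  have j4 : s4 vj 0 0 = j by rewrite F4 // -sj -[RHS]MP1.
  have c4 : s4 vc 0 0 = c by rewrite F4 // -sc -[RHS]MP1.
  rewrite exec_Assign /upd /= big_ord_recr /= -I4 s4i (env_w E4).
  rewrite (env_pow E4) ?(ltnW vk4) //.
  by rewrite j4 c4 (env_G E4) addn1 -/(dig w c v).
have F3 x : [|| var_beq x vMIS, var_beq x vPRED, var_beq x vj, var_beq x vc
               | var_beq x vARG] ->
    forall a b, s3 x a b = s1 x a b.
  by move=> hx a b; rewrite /s3 exec_frame //; case: x hx.
exists (s1 vARG 0 0).
  move: B1; rewrite /best; case: ifP => _.
    (* The empty subset is always a candidate, so [vFOUND] cannot be 0. *)
    have [val0 win0] := pred_code0 w_gt0 j0 win.
    by move=> /(_ (pred_code k w c 0)) []; exists 0; split; rewrite ?expn_gt0.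
  move=> [[m [mk vm dm wm]] _ maxA]; split=> //; first by exists m.
  by move=> m' mk' vm' wm'; apply: maxA; exists m'.
split=> y z.
  rewrite exec_frame // exec_Assign /upd /= g3.
  by rewrite !F3 // (MP1 vj) // (MP1 vc) // sj sc subn1 !(MP1 vMIS).
rewrite !exec_Assign /upd /= !F3 // (MP1 vj) // (MP1 vc) // sj sc.
by rewrite (MP1 vPRED).
Qed.

(** * Invariants of the tables *)

(** Visited cells satisfy the recurrence, the others keep their initial 0. Nothing is said about
    infeasible codes, whose cells hold arbitrary memory. *)
Definition partial_table (visited : nat -> nat -> bool) (s : state) : Prop :=
  s vMIS 0 0 = 0 /\
  forall j c, 0 < j <= n -> c < w.+1 ^ k -> code_feasible k l w c ->
    if visited j c && code_window k l w G j c then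
      best_pred (s vMIS j.-1) j c (s vPRED j c) /\
      s vMIS j c = code_gain j c + s vMIS j.-1 (s vPRED j c)
    else s vMIS j c = 0.

Lemma partial_table_ext visited visited' s s' :
  (forall a b, s' vMIS a b = s vMIS a b) -> (forall a b, s' vPRED a b = s vPRED a b) ->
  (forall j c, 0 < j <= n -> c < w.+1 ^ k -> visited' j c = visited j c) ->
  partial_table visited s -> partial_table visited' s'.
Proof.
move=> eM eP ev [M0 H]; split=> [|j c jn cN fc]; first by rewrite eM.
have := H j c jn cN fc; rewrite ev //; case: ifP => _; last by rewrite eM.
rewrite eP !eM => - [[B1 B2 B3] ->]; split=> //.
by split=> // m; rewrite !eM; apply: B3.
Qed.

Definition cell : com :=
  (check_window vj vc;; If vOK update_cell Skip)%ram.

(** Visited rows do not exceed [j], so they refer to rows below [j]; writing in row [j] leaves their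
    recurrences intact. *)
Lemma cell_spec (visited : nat -> nat -> bool) s j c :
  env s -> s vj 0 0 = j -> s vc 0 0 = c -> 0 < j <= n -> c < w.+1 ^ k ->
  (forall j' c', visited j' c' -> j' <= j) ->
  partial_table visited s ->
  partial_table (fun j' c' => visited j' c' || (j == j') && (c == c')) (exec cell s).
Proof.
move=> E sj sc jn cN vis T; rewrite /cell exec_Seq.
set s1 := exec (check_window vj vc) s.
have F1 : frame (check_window vj vc) s s1 by apply: exec_frame.
have E1 : env s1 by apply: env_frame F1 _ E; case.
have ok1 : (s1 vOK 0 0 != 0) = code_window k l w G j c.
  by rewrite check_window_spec //= ?sj ?sc //; case.
have T1 : partial_table visited s1 by apply: partial_table_ext T => // a b; rewrite F1.
rewrite exec_If [eval vOK s1]/= ok1; case: ifP => win; last first.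
  case: T1 => M0 H; split=> // j' c' jn' cN' fc'.
  have := H j' c' jn' cN' fc'; case: (eqVneq j j') => [<-|_]; last by rewrite orbF.
  by case: (eqVneq c c') => [<-|_]; rewrite ?win ?andbF ?orbF.
have [j0 _] := andP jn.
have s1j : s1 vj 0 0 = j by rewrite F1.
have s1c : s1 vc 0 0 = c by rewrite F1.
have [a best_a [eM eP]] := update_cell_spec E1 s1j s1c j0 win.
move: eM eP; set s2 := exec update_cell s1 => eM eP.
have pred_row j' : 0 < j' <= j -> forall z, s2 vMIS j'.-1 z = s1 vMIS j'.-1 z.
  by move=> j'j z; rewrite eM (_ : j == j'.-1 = false) //; apply/eqP; lia.
case: T1 => M0 H; split=> [|j' c' jn' cN' fc'].
  by have /= -> := pred_row 1 j0 0.
have := H j' c' jn' cN' fc'.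
have trans d x : j' <= j -> best_pred (s1 vMIS j'.-1) j' d x ->
    best_pred (s2 vMIS j'.-1) j' d x.
  move=> j'j [B1 B2 B3]; split=> // m mk vm wm.
  by rewrite !pred_row ?j'j ?andbT; [exact: B3 | lia | lia].
have row := pred_row j'.
case jj: (j == j'); last first.
  rewrite orbF; case: ifP => [/andP[v _]|_]; last by rewrite eM jj.
  have j'j := vis _ _ v.
  move=> [B1 B2]; rewrite eP eM jj /= row; last by lia.
  by split=> //; apply: trans.
rewrite -(eqP jj) in row trans *; case cc: (c == c').
  rewrite -(eqP cc) win orbT /= eM eP !eqxx /= => _.
  by rewrite row ?j0 ?leqnn //; split=> //; apply: trans.
rewrite orbF; case: ifP => [/andP[v _]|_]; last by rewrite eM cc andbF.
move=> [B1 B2]; rewrite eP eM cc andbF /= row; last by lia.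
by split=> //; apply: trans.
Qed.

Lemma main_loop_spec s : env s -> partial_table (fun _ _ => false) s ->
  partial_table (fun _ _ => true) (exec main_loop s).
Proof.
move=> E T; suff : partial_table (fun j _ => j <= n) (exec main_loop s).
  by apply: partial_table_ext => // j c /andP[_ ->].
apply: (for_ind (I := fun v => partial_table (fun j _ => j <= v))
  (env_n E : eval vn s = n)).
- by apply: partial_table_ext T => // j c /andP[]; case: j.
- by move=> v u s'; apply: partial_table_ext.
move=> t s1 tn F1 s1t T1.
rewrite exec_Seq; set s2 := exec (vj <~ vt + 1)%ram s1.
have F2 : frame main_loop s s2.
  move=> x nx a b; rewrite -F1; last by case: x nx.
  by rewrite /s2 exec_frame //; case: x nx.
have E2 : env s2 by apply: env_frame F2 _ E; case.
have s2j : s2 vj 0 0 = t.+1 by rewrite /s2 /= /upd /= s1t addn1.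
have e2 : eval vPOW@[vk, 0]%ram s2 = w.+1 ^ k by rewrite /= (env_k E2) (env_pow E2).
(* During pass [t] the visited cells are the rows up to [t] and an initial segment of row [t.+1]. *)
suff : partial_table (fun j c => (j <= t) || (t.+1 == j) && (c < w.+1 ^ k))
   (exec (For vc vPOW@[vk, 0] cell)%ram s2).
  apply: partial_table_ext => // j c _ ->.
  by rewrite andbT leq_eqVlt eq_sym orbC.
apply: (for_ind (I := fun u =>
  partial_table (fun j c => (j <= t) || (t.+1 == j) && (c < u))) e2).
- by apply: partial_table_ext T1 => // j c _ _; rewrite andbF orbF.
- by move=> v u s'; apply: partial_table_ext.
move=> c s3 cN F3 s3c T3.
have E3 : env s3 by apply: env_frame F3 _ E2; case.
have s3j : s3 vj 0 0 = t.+1 by rewrite F3.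
suff : partial_table (fun j' c' => ((j' <= t) || (t.+1 == j') && (c' < c))
    || (t.+1 == j') && (c == c')) (exec cell s3).
  apply: partial_table_ext => // j' c' _ _.
  by rewrite ltnS [c' <= c]leq_eqVlt -orbA -andb_orr (eq_sym c') (orbC (c == c')).
apply: cell_spec => // j' c' /orP[/leqW//|/andP[/eqP<- //]].
Qed.

Lemma initialisation_spec s : env s ->
  partial_table (fun _ _ => false) (exec initialisation s).
Proof.
move=> E; rewrite /initialisation exec_Seq.
set s0 := exec (vMIS <~[0, 0] 0)%ram s.
have F0 : frame (vMIS <~[0, 0] 0)%ram s s0 by apply: exec_frame.
have E0 : env s0 by apply: env_frame F0 _ E; case.
pose I (P : nat -> nat -> bool) (s' : state) := s' vMIS 0 0 = 0 /\
  forall j c, c < w.+1 ^ k -> code_feasible k l w c -> 0 < j -> P j c ->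
    s' vMIS j c = 0.
suff [M0 H] : I (fun j _ => j <= n) (exec (For vt vn (For vc vPOW@[vk, 0] (
      check_feasible vc;; If vOK (vMIS <~[vt + 1, vc] 0) Skip)))%ram s0).
  by split=> // j c /andP[j0 jn] cN fc /=; apply: H.
apply: (for_ind (I := fun v => I (fun j _ => j <= v)) (env_n E0 : eval vn s0 = n)) => //.
  by split=> // - [].
move=> t s1 tn F1 s1t [M1 H1].
have E1 : env s1 by apply: env_frame F1 _ E0; case.
have e1 : eval vPOW@[vk, 0]%ram s1 = w.+1 ^ k by rewrite /= (env_k E1) (env_pow E1).
suff [M2 H2] : I (fun j c => (j <= t) || (t.+1 == j) && (c < w.+1 ^ k))
    (exec (For vc vPOW@[vk, 0] (
      check_feasible vc;; If vOK (vMIS <~[vt + 1, vc] 0) Skip))%ram s1).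
  split=> // j c cN fc j0; rewrite leq_eqVlt => jt; apply: H2 => //.
  by rewrite cN andbT eq_sym orbC.
apply: (for_ind (I := fun u =>
   I (fun j c => (j <= t) || (t.+1 == j) && (c < u))) e1) => //.
  by split=> // j c cN fc j0; rewrite andbF orbF; apply: H1.
move=> c s2 cN F2 s2c [M2 H2]; rewrite exec_Seq.
set s3 := exec (check_feasible vc) s2.
have E2 : env s2 by apply: env_frame F2 _ E1; case.
have F3 : frame (check_feasible vc) s2 s3 by apply: exec_frame.
have ok3 : (s3 vOK 0 0 != 0) = code_feasible k l w c.
  by rewrite check_feasible_spec //= ?s2c //; case.
have t3 : s3 vt 0 0 = t by rewrite F3 // F2.
have c3 : s3 vc 0 0 = c by rewrite F3.
rewrite exec_If [eval vOK s3]/= ok3 exec_Assign /= t3 c3 addn1.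
have M3 a b : s3 vMIS a b = s2 vMIS a b by rewrite F3.
case: ifP => fc; (split=> [|j c' cN' fc' j0]; rewrite /upd /= ?M3 //).
  rewrite ltnS [c' <= c]leq_eqVlt => H; case: ifP => // /negbT; rewrite negb_and => ne.
  apply: H2 => //; case/orP: H => [->//|/andP[/eqP jt]].
  by move: ne; rewrite jt eqxx /= (eq_sym c) => /negbTE-> /= ->; rewrite orbT.
rewrite ltnS [c' <= c]leq_eqVlt => H; apply: H2 => //.
case/orP: H => [->//|/andP[jt /orP[/eqP cc|cc]]]; last by rewrite jt cc orbT.
by rewrite -cc fc' in fc.
Qed.

(** * Retrieval of the schedule *)

Lemma output_column_spec j s : env s ->
  (forall x, reads j x -> ~~ writes (output_column j) x) ->
  let s' := exec (output_column j) s in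
  (forall i, i < k -> s' vOUT i (eval j s) = (dig w (s vARG 0 0) i == w)) /\
  (forall i b, b != eval j s -> s' vOUT i b = s vOUT i b).
Proof.
move=> E rj.
pose I v (s' : state) :=
  (forall i, i < v -> s' vOUT i (eval j s) = (dig w (s vARG 0 0) i == w)) /\
  (forall i b, b != eval j s -> s' vOUT i b = s vOUT i b).
apply: (for_ind (I := I) (env_k E : eval vk s = k)) => //.
move=> v s1 vk1 F1 s1i [I1 J1].
have E1 : env s1 by apply: env_frame F1 _ E; case.
have ej : eval j s1 = eval j s by apply: eval_frame F1 rj.
have vk2 := ltnW vk1.
rewrite exec_Assign /= s1i ej (env_w E1) (env_pow E1) // F1 // addn1.
split=> [i|i b nb]; rewrite /upd /=; last first.
  by rewrite [eval j s == b]eq_sym (negbTE nb) andbF J1.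
rewrite ltnS leq_eqVlt eqxx andbT eq_sym; case: eqVneq => [<- _|_ /I1 //].
by rewrite -/(dig w _ _).
Qed.

Lemma code_window0 j : code_window k l w G j 0.
Proof.
have d0 i : dig w 0 i = 0 by rewrite /dig div0n mod0n.
apply/andP; split; apply/all_iotaP => i; rewrite !d0 //.
by rewrite big1 // => i' _.
Qed.

(** Starting from a code at time [n], the code at time [n - e] after [e] predecessor steps. *)
Definition walk (P : nat -> nat -> nat) (c e : nat) : nat :=
  iteri e (fun e' => P (n - e')) c.

Lemma retrieval_spec s : env s -> 0 < n ->
  exists2 c, [/\ c < w.+1 ^ k, code_window k l w G n c
      & forall d, d < w.+1 ^ k -> code_window k l w G n d -> s vMIS n d <= s vMIS n c]
    & forall e i, e < n -> i < k ->
        exec retrieval s vOUT i (n - e) = (dig w (walk (s vPRED) c e) i == w).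
Proof.
move=> E n0; rewrite /retrieval 3!exec_Seq.
set s0 := exec (vFOUND <~ 0)%ram s; set s1 := exec _ s0.
have F0 : frame retrieval s s0.
  by move=> x nx a b; apply: exec_frame; case: x nx.
have E0 : env s0 by apply: env_frame F0 _ E; case.
pose cand v d := d < v /\ code_window k l w G n d.
have B1 : best (s vMIS n) (cand (w.+1 ^ k)) s1.
  have e0 : eval vPOW@[vk, 0]%ram s0 = w.+1 ^ k by rewrite /= (env_k E0) (env_pow E0).
  apply: (for_ind (I := fun v => best (s vMIS n) (cand v)) e0) => //.
    by move=> d [].
  move=> c s2 cN F2 s2c B2; rewrite exec_Seq; set s3 := exec (check_window vn vc) s2.
  have E2 : env s2 by apply: env_frame F2 _ E0; case.
  have F3 : frame (check_window vn vc) s2 s3 by apply: exec_frame.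
  have E3 : env s3 by apply: env_frame F3 _ E2; case.
  have c3 : s3 vc 0 0 = c by rewrite F3.
  have ok3 : (s3 vOK 0 0 != 0) = code_window k l w G n c.
    by rewrite check_window_spec //= ?s2c ?(env_n E2) //; case.
  have B3 : best (s vMIS n) (cand c) s3 by apply: best_ext B2; rewrite ?F3.
  rewrite exec_If [eval vOK s3]/= ok3; case: ifP => win; last first.
    apply: best_ext B3 => // d; split=> [[dc wd]|[+ wd]].
      by split=> //; apply: leqW.
    rewrite ltnS leq_eqVlt => /predU1P[dc|dc]; last by split.
    by rewrite dc win in wd.
  apply: best_ext (keep_best_spec (j := vn) (e := vc) (mis := s vMIS n) _ _ B3) => //.
  - rewrite /= c3 => d; split=> [[[dc wd]|->]|[+ wd]].
      by split=> //; apply: leqW.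
      by split.
    by rewrite ltnS leq_eqVlt => /predU1P[dc|dc]; [right | left].
  - by rewrite /= c3 (env_n E3) F3 // F2 // F0.
  - by case.
move: B1; rewrite /best; case: ifP => _.
  (* The zero window belongs to every family, so the final search finds a maximizer. *)
  by move=> /(_ 0) []; split; rewrite ?expn_gt0 ?code_window0.
move=> [[cN win] _ maxc]; set c := s1 vARG 0 0 in cN win maxc *.
exists c; first by split=> // d dN wd; apply: maxc.
have F1 : frame retrieval s s1.
  by move=> x nx a b; rewrite -F0 // /s1 exec_frame //; case: x nx.
have E1 : env s1 by apply: env_frame F1 _ E; case.
set s2 := exec (output_column vn) s1.
have [O2 _] : _ /\ _ := @output_column_spec vn s1 E1 ltac:(by case).
rewrite -/s2 [eval vn s1]/= (env_n E1) in O2.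
have F2 : frame (output_column vn) s1 s2 by apply: exec_frame.
have E2 : env s2 by apply: env_frame F2 _ E1; case.
have e2 : eval (vn - 1)%ram s2 = n.-1 by rewrite /= (env_n E2) subn1.
pose I v s' := s' vARG 0 0 = walk (s vPRED) c v /\
  forall e i, e <= v -> i < k -> s' vOUT i (n - e) = (dig w (walk (s vPRED) c e) i == w).
suff [_ O3] : I n.-1 (exec (For vt (vn - 1) (vj <~ vn - vt;;
    vARG <~ vPRED@[vj, vARG];; output_column (vj - 1)))%ram s2).
  by move=> e i en; apply: O3; rewrite -ltnS prednK.
apply: (for_ind (I := I) e2) => //.
  by split=> [|e i]; [rewrite F2 | rewrite leqn0 => /eqP-> ik; rewrite subn0 O2].
move=> v s3 vn1 F3 s3t [A3 O3]; rewrite 2!exec_Seq.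
set s4 := exec (vj <~ vn - vt)%ram s3; set s5 := exec (vARG <~ _)%ram s4.
have E3 : env s3 by apply: env_frame F3 _ E2; case.
have s4j : s4 vj 0 0 = n - v by rewrite /s4 /= /upd /= (env_n E3) s3t.
have F5 : frame (vj <~ vn - vt;; vARG <~ vPRED@[vj, vARG])%ram s3 s5 by apply: exec_frame.
have E5 : env s5 by apply: env_frame F5 _ E3; case.
have s5j : s5 vj 0 0 = n - v by rewrite -s4j.
have s5A : s5 vARG 0 0 = walk (s vPRED) c v.+1.
  have -> : s5 vARG 0 0 = s3 vPRED (s4 vj 0 0) (s3 vARG 0 0) by [].
  by rewrite s4j A3 F3 // F2 // F1.
have [O6 K6] := @output_column_spec (vj - 1)%ram s5 E5 ltac:(by case).
move: O6 K6; rewrite [eval _ s5]/= s5j subn1 -subnS s5A => O6 K6.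
split=> [|e i]; first by rewrite exec_frame.
rewrite leq_eqVlt => /predU1P[->|ev] ik; first exact: O6.
(* Distinct backward steps write distinct columns, so the output already written survives. *)
rewrite K6 ?F5 ?O3 //; apply/eqP; lia.
Qed.

End Subprograms.

Lemma powers_spec (k l n w : nat) (s : state) :
  s vk 0 0 = k -> s vl 0 0 = l -> s vn 0 0 = n -> s vw 0 0 = w ->
  env k l n w (s vG) (exec powers s).
Proof.
move=> sk sl sn sw.
have F : frame powers s (exec powers s) by apply: exec_frame.
pose I v (s' : state) :=
  forall i, i <= v -> s' vPOW i 0 = w.+1 ^ i /\ s' vTWO i 0 = 2 ^ i.
suff H : I k (exec powers s).
  split; rewrite ?F //; first by move=> i c; rewrite F.
    by move=> i /H [].
  by move=> i /H [].
rewrite /powers 2!exec_Seq; set s0 := exec _ (exec _ s).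
apply: (for_ind (I := I) (sk : eval vk s0 = k)) => //.
  by move=> i; rewrite leqn0 => /eqP->.
move=> v s1 vk1 F1 s1i I1; have [P1 T1] := I1 v (leqnn v).
have w1 : s1 vw 0 0 = w by rewrite F1.
rewrite exec_Seq !exec_Assign /upd /= s1i P1 T1 w1 !addn1.
move=> i; case: (eqVneq v.+1 i) => [<- _|ne iv] /=.
  by rewrite !expnSr.
by apply: I1; rewrite -ltnS ltn_neqAle eq_sym ne.
Qed.

(** * Running time of the program *)

(** Loop lengths are read off the head of the bounding expression; the last case covers [vn] and
    [vn - 1]. *)
Definition loop_count (k n N M : nat) (e : exp) : nat :=
  match e with
  | Cell vk _ _ => k
  | Cell vPOW _ _ => N
  | Cell vTWO _ _ => M
  | _ => n
  end.

(* The loops over time points and over window codes contribute their lengths as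
   factors; all the other loops have lengths that depend on [k] only. *)
Definition scaled (k n N M Y : nat) (c : com) : Prop :=
  bound (loop_count k n N M) c <= bound (loop_count k 1 1 M) c * Y.

Section Scaled.

Variables (k n N M : nat).
Local Notation scaled := (scaled k n N M).

Lemma scaled_const Y c : 0 < Y ->
  bound (loop_count k n N M) c = bound (loop_count k 1 1 M) c -> scaled Y c.
Proof. by rewrite /scaled => Y0 ->; apply: leq_pmulr. Qed.

Lemma scaled_weaken Y Y' c : Y <= Y' -> scaled Y c -> scaled Y' c.
Proof. by move=> YY h; apply: leq_trans h _; rewrite leq_mul2l YY orbT. Qed.

Lemma scaled_Seq Y c1 c2 : scaled Y c1 -> scaled Y c2 -> scaled Y (Seq c1 c2).
Proof. by rewrite /scaled /= mulnDl; apply: leq_add. Qed.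

(** The length of the loop passes into the scale; the constant overheads are absorbed because the
    new scale is positive. *)
Lemma scaled_For x e c Y : 0 < loop_count k n N M e -> 0 < Y ->
  loop_count k 1 1 M e = 1 -> scaled Y c ->
  scaled (loop_count k n N M e * Y) (For x e c).
Proof.
rewrite /scaled /= => + Y0 ->; move: (loop_count _ _ _ _ e) => m m0 h.
have := leq_pmulr (exp_time e) (_ : 0 < m * Y); rewrite muln_gt0 m0 Y0 => /(_ isT).
have := leq_pmulr m Y0; have : 0 < m * Y by rewrite muln_gt0 m0.
move: h; rewrite -(leq_pmul2l m0) mulnCA mul1n mulnS !mulSn mulnDl mulSn; lia.
Qed.

End Scaled.

Lemma algorithm1_time (k l n w : nat) (s : state) : 0 < k -> 0 < n -> 0 < w ->
  s vk 0 0 = k -> s vl 0 0 = l -> s vn 0 0 = n -> s vw 0 0 = w ->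
  time algorithm1 s <=
    (bound (loop_count k 1 1 1) powers +
     bound (loop_count k 1 1 (2 ^ k)) (initialisation;; main_loop;; retrieval)%ram)
    * 2 ^ k * (n * k ^ l * w ^ k).
Proof.
move=> k0 n0 w0 sk sl sn sw.
set rest := (initialisation;; _)%ram; set B := bound _ rest.
(* The power tables that bound later loops are correct only after [powers], which is therefore timed
   separately, with the value of [vk] as its only invariant. *)
have tp : time powers s <= bound (loop_count k 1 1 1) powers.
  apply: (@time_bound (fun x => var_beq x vk) (fun s => s vk 0 0 = k)) => //.
    by move=> s1 s2 h <-; apply: h.
  by rewrite /=; do ![split => //]; move=> s' ->.
have N0 : 0 < w.+1 ^ k by rewrite expn_gt0.
have tr : time rest (exec powers s) <= B * (n * w.+1 ^ k).
  apply: (@leq_trans (bound (loop_count k n (w.+1 ^ k) (2 ^ k)) rest)).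
    apply: (@time_bound constant_var (env k l n w (s vG))) (powers_spec sk sl sn sw).
      exact: env_agree.
    have ek s' : env k l n w (s vG) s' -> s' vk 0 0 <= k by move/env_k->.
    have en s' : env k l n w (s vG) s' -> s' vn 0 0 <= n by move/env_n->.
    have en1 s' : env k l n w (s vG) s' -> s' vn 0 0 - 1 <= n.
      by move/env_n->; apply: leq_subr.
    have eN s' : env k l n w (s vG) s' -> s' vPOW (s' vk 0 0) 0 <= w.+1 ^ k.
      by move=> E; rewrite (env_k E) (env_pow E).
    have eM s' : env k l n w (s vG) s' -> s' vTWO (s' vk 0 0) 0 <= 2 ^ k.
      by move=> E; rewrite (env_k E) (env_two E).
    by rewrite /=; do ![split => //].
  have loopN x c : 
      bound (loop_count k n (w.+1 ^ k) (2 ^ k)) c = bound (loop_count k 1 1 (2 ^ k)) c ->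
      scaled k n (w.+1 ^ k) (2 ^ k) (w.+1 ^ k) (For x vPOW@[vk, 0] c)%ram.
    move=> ec; rewrite -[X in scaled _ _ _ _ X]muln1.
    by apply: (@scaled_For _ _ _ _ x vPOW@[vk, 0]%ram) => //; apply: scaled_const.
  have nN : 0 < n * w.+1 ^ k by rewrite muln_gt0 n0.
  apply: scaled_Seq.
    apply: scaled_Seq; first exact: scaled_const.
    by apply: (@scaled_For _ _ _ _ vt vn) => //; apply: loopN.
  apply: scaled_Seq.
    apply: (@scaled_For _ _ _ _ vt vn) => //.
    by apply: scaled_Seq; [exact: scaled_const | exact: loopN].
  apply: scaled_Seq; first exact: scaled_const.
  apply: scaled_Seq.
    by apply: scaled_weaken (loopN _ _ _) => //; rewrite leq_pmull.
  apply: scaled_Seq; first exact: scaled_const.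
  apply: (@scaled_weaken _ _ _ _ (n * 1)); first by rewrite leq_mul2l N0 orbT.
  by apply: (@scaled_For _ _ _ _ vt (vn - 1)%ram) => //; apply: scaled_const.
have -> : time algorithm1 s = time powers s + time rest (exec powers s) by [].
apply: leq_trans (leq_add tp tr) _.
set P := bound _ powers; have nN : 0 < n * w.+1 ^ k by rewrite muln_gt0 n0.
apply: (@leq_trans ((P + B) * (n * w.+1 ^ k))).
  by rewrite mulnDl leq_add2r leq_pmulr.
rewrite -mulnA leq_mul2l; apply/orP; right.
(* Since [w] is positive, [w + 1 <= 2 * w]; this factor [2 ^ k] goes into the constant. *)
have wk : w.+1 ^ k <= 2 ^ k * w ^ k.
  by rewrite -expnMn leq_exp2r // mul2n -addnn -addn1 leq_add2l.
rewrite mulnCA -!mulnA leq_mul2l; apply/orP; right.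
apply: leq_trans wk _.
by apply: leq_pmull; rewrite expn_gt0 k0.
Qed.

(** * From codes back to windows *)

(** Coding is a bijection between windows with at most one one per row and numbers below [w.+1 ^ k],
    so the table invariants and the retrieval path translate into the conditions of a run. *)
Lemma exec_algorithm1_run (k n l w : nat) (A : 'M[bool]_(k, n)) (s : state) :
  0 < n -> 0 < w -> input_state l w A s ->
  algorithm1_run l A (@MIS_table k w (exec algorithm1 s))
    (@pred_table k w (exec algorithm1 s)) (output k n (exec algorithm1 s)).
Proof.
move=> n0 w0 [sk sl sn sw sG].
have E1 := powers_spec sk sl sn sw; set s1 := exec powers s in E1.
have T2 := initialisation_spec E1; set s2 := exec initialisation s1 in T2.
have F2 : frame initialisation s1 s2 by apply: exec_frame.
have E2 : env k l n w (s vG) s2 by apply: env_frame F2 _ E1; case.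
have T3 := main_loop_spec w0 E2 T2; set s3 := exec main_loop s2 in T3.
have F3 : frame main_loop s2 s3 by apply: exec_frame.
have E3 : env k l n w (s vG) s3 by apply: env_frame F3 _ E2; case.
have [c0 [c0N win0 max0] out] := retrieval_spec w0 E3 n0.
have -> : exec algorithm1 s = exec retrieval s3 by [].
set f := exec retrieval s3 in out *.
have F4 : frame retrieval s3 f by apply: exec_frame.
have fM a b : f vMIS a b = s3 vMIS a b by rewrite F4.
have fP a b : f vPRED a b = s3 vPRED a b by rewrite F4.
have GA : stored w A (s vG) by [].
have winE c j : j <= n -> (decode k w c \in windows l w A j) =
    code_window k l w (s vG) j c by apply: code_windowE.
case: T3 => M0 T3.
have step j c : 0 < j <= n -> c < w.+1 ^ k -> code_window k l w (s vG) j c ->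
    best_pred k l w (s vG) (s3 vMIS j.-1) j c (s3 vPRED j c) /\
    s3 vMIS j c = code_gain k w (s vG) j c + s3 vMIS j.-1 (s3 vPRED j c).
  move=> jn cN win; have := T3 j c jn cN; rewrite win; apply.
  by case/andP: win.
have last_dig c i : last_column (decode k w c) i = (dig w c i == w).
  have wp : w.-1 < w by rewrite prednK.
  by rewrite (@last_columnE _ _ _ i (Ordinal wp)) ?decodeE /= prednK.
have stored_last (i : 'I_k) j : 0 < j <= n -> s vG i (j + w - 1) = padded A i (Posz j).
  by move=> jn; rewrite GA; [congr (nat_of_bool (padded _ _ _)) | ]; lia.
have predN j c : 0 < j <= n -> c < w.+1 ^ k -> code_window k l w (s vG) j c ->
    s3 vPRED j c < w.+1 ^ k.
  by move=> jn cN /step [] // [[m _ [_ ->]] _ _] _; apply: pred_code_lt.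
have code j (W : 'M[bool]_(k, w)) : j <= n -> W \in windows l w A j ->
    [/\ encode W < w.+1 ^ k, decode k w (encode W) = W
      & code_window k l w (s vG) j (encode W)].
  move=> jn Wj; have [_ W1 _] := windowsP _ _ _ _ Wj.
  by rewrite -winE // encodeK ?encode_lt.
split.
- rewrite /MIS_table fM (_ : encode _ = 0) // /encode big1 // => i _.
  by rewrite big1 // => p _; rewrite mxE.
- move=> j W jn feasW nW; have [W1 _] := andP feasW.
  have {}W1 : forall i, \sum_(p < w) W i p <= 1 by apply/forallP.
  have cN := encode_lt W1; have jn' : j <= n by case/andP: jn.
  rewrite /MIS_table fM; have := T3 j (encode W) jn cN.
  rewrite -code_feasibleE -winE // encodeK // (negbTE nW) andbF.
  exact.
- move=> j W jn Wj; have jn' : j <= n by case/andP: jn.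
  have j1n : j.-1 <= n by apply: leq_trans (leq_pred _) jn'.
  have [cN cW win] := code _ _ jn' Wj.
  have [[[m mk [vm Pm]] winP maxP] _] := step _ _ jn cN win.
  rewrite /pred_table fP; split.
  + by rewrite winE.
  + by rewrite -[X in overlaps _ X]cW Pm; apply: pred_code_overlaps.
  (* Any competitor [W'] arises from some subset of rows, to which maximality over subsets
     applies. *)
  + move=> W' W'j; rewrite -cW => /(pred_code_complete w0) H.
    have [cN' cW' win'] := code _ _ j1n W'j; have [_ W1' _] := windowsP _ _ _ _ W'j.
    have [m' mk' [vm' Pm']] := H W1'.
    rewrite /MIS_table !fM cW decodeK ?predN //.
    by rewrite -Pm'; apply: maxP => //; rewrite Pm'.
- move=> j W jn Wj; have jn' : j <= n by case/andP: jn.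
  have [cN cW win] := code _ _ jn' Wj.
  have [_ eM] := step _ _ jn cN win.
  rewrite /MIS_table /pred_table !fM fP decodeK ?predN // eM; congr (_ + _).
  apply: eq_bigr => i _; rewrite -{2}cW last_dig; congr (_ * _).
  by rewrite stored_last.
(* The window at time [j] lies [n - j] predecessor steps behind the maximizer [c0]. *)
pose V j := decode k w (walk n (s3 vPRED) c0 (n - j)).
have walkP e : e < n -> walk n (s3 vPRED) c0 e < w.+1 ^ k /\
    code_window k l w (s vG) (n - e) (walk n (s3 vPRED) c0 e).
  elim: e => [|e IH] en; first by rewrite subn0.
  have [cN win] := IH (ltnW en); have ne : 0 < n - e <= n by lia.
  split; first exact: predN.
  by have [[_ + _] _] := step _ _ ne cN win; rewrite -subnS.
exists V; split.
- by rewrite /V subnn winE.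
- move=> W' W'n; have [cN' cW' win'] := code _ _ (leqnn n) W'n.
  by rewrite /MIS_table /V subnn !fM decodeK //; apply: max0.
- move=> j jn; have e1 : n - j < n by lia.
  have [cN _] := walkP _ e1.
  rewrite /pred_table /V fP decodeK // (_ : n - j.-1 = (n - j).+1); last lia.
  by rewrite /walk /= subKn //; lia.
- move=> i t; rewrite mxE -{1}(subKn (ltn_ord t)) out //; last by have := ltn_ord t; lia.
  by rewrite /V last_dig eqb0 negbK.
Qed.

Theorem theorem2 (k : nat) (k_gt0 : 0 < k) :
  (forall (n l w : nat) (A : 'M[bool]_(k, n))
      (MIS : nat -> 'M[bool]_(k, w) -> nat)
      (pred : nat -> 'M[bool]_(k, w) -> 'M[bool]_(k, w))
      (I : 'M[bool]_(k, n)),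
     0 < n -> 0 < w ->
     algorithm1_run l A MIS pred I -> optimal_schedule l w A I) /\
  (exists C : nat,
     forall (n l w : nat) (A : 'M[bool]_(k, n)) (s : state),
       0 < n -> 0 < w -> input_state l w A s ->
       algorithm1_run l A (@MIS_table k w (exec algorithm1 s))
         (@pred_table k w (exec algorithm1 s)) (output k n (exec algorithm1 s)) /\
       time algorithm1 s <= C * (n * k ^ l * w ^ k)).
Proof.
split=> [n l w A MIS pred I|]; first exact: algorithm1_run_optimal.
(* With the lengths of the loops over time points and codes set to one, these bounds depend on [k]
   alone. *)
exists ((bound (loop_count k 1 1 1) powers +
  bound (loop_count k 1 1 (2 ^ k)) (initialisation;; main_loop;; retrieval)%ram) * 2 ^ k).
move=> n l w A s n0 w0 [sk sl sn sw sG].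
split; last exact: algorithm1_time.
exact: exec_algorithm1_run.
Qed.
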